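(* Fix $n>0$ and positive integers $k_1,\ldots,k_s$ with $s\ge1$, such that $\sum_{i=1}^sk_i-s-n+1=2g$ for some integer $g\ge0$. Then the quantity $$H_{|\beta|,|\beta|}(k_1,\ldots,k_s;(|\beta|),\beta)\times Aut(\beta)\times|\beta|,\qquad \beta=(\beta_1,\ldots,\beta_n),\ |\beta|=\beta_1+\cdots+\beta_n,$$ is a polynomial in $\beta_1,\ldots,\beta_n$ whose lowest degree (smallest total degree of a monomial with nonzero coefficient) is $s$ and whose highest degree is $\big(\sum_{i=1}^sk_i\big)-n+1$.
   Context: Here $\beta_1,\ldots,\beta_n$ range over positive integers, viewed as the parts of a partition $\beta$, and $Aut(\beta)=\prod_ia_i!$ for $\beta=[1^{a_1},2^{a_2},\ldots]$. $\mathcal{C}_\lambda$ is the conjugacy class of cycle type $\lambda$ in $\mathfrak{S}_{|\lambda|}$, $\chi^\lambda$ the irreducible character indexed by $\lambda$, $\chi^\lambda_\mu$ its value on $\mathcal{C}_\mu$, $\dim(\lambda)$ its degree, $\ell(\lambda)$ the number of parts and $m_1(\lambda)$ the number of parts equal to 1. For $k\ge1$ let $p_k(\lambda)=\sum_{i\ge1}\big[(\lambda_i-i+\tfrac12)^k-(-i+\tfrac12)^k\big]$. Let $f_\eta(\mu)=\binom{|\mu|}{|\eta|}|\mathcal{C}_\eta|\chi^\mu_\eta/\dim(\mu)$, where $f_\eta(\mu)=0$ if $|\mu|<|\eta|$, where for $|\mu|>|\eta|$ the value $\chi^\mu_\eta$ is taken at cycle type $\eta$ with $|\mu|-|\eta|$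 fixed points added, and $f_\varnothing=1$. The $f_\eta$ form a basis of the algebra of shifted symmetric functions; write $p_k=\sum_\eta\kappa_{k,\eta}f_\eta$. For $|\eta|\le d$ let $\eta^{\uparrow d}\vdash d$ be $\eta$ with $d-|\eta|$ parts equal to 1 added. For $\mu^1,\ldots,\mu^r\vdash d$, $$H_d(k_1,\ldots,k_s;\mu^1,\ldots,\mu^r)=\frac1{d!}\sum_{\eta_1,\ldots,\eta_s,\ |\eta_i|\le d}\ \prod_{i=1}^s\frac{\kappa_{k_i,\eta_i}}{k_i!}\binom{m_1(\eta_i^{\uparrow d})}{m_1(\eta_i)}\cdot N,$$ where $N$ is the number of tuples $(\sigma_1,\ldots,\sigma_s,\pi_1,\ldots,\pi_r)$ in $\mathfrak{S}_d$ with $\sigma_1\cdots\sigma_s\pi_1\cdots\pi_r=1$, $\sigma_i$ of cycle type $\eta_i^{\uparrow d}$, $\pi_j$ of cycle type $\mu^j$. Finally $H_{d,m}(k_1,\ldots,k_s;\mu^1,\ldots,\mu^r)=\sum_{\mu^{r+1}\vdash d,\ \ell(\mu^{r+1})=m}H_d(k_1,\ldots,k_s;\mu^1,\ldots,\mu^{r+1})$. *)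

(* Defs.v *)
(* Written over Mathematical Components (fingroup, character, multinomials). *)
From mathcomp Require Import all_boot all_order all_fingroup all_algebra.
From mathcomp Require Import all_solvable all_field all_character.
From mathcomp Require Import mpoly.

Set Implicit Arguments.
Unset Strict Implicit.
Unset Printing Implicit Defensive.

Import GroupScope GRing.Theory.
Local Open Scope ring_scope.

(* A partition is the weakly decreasing sequence of its (nonzero) parts; its
   size is [sumn l], its number of parts [size l], the number of parts equal to
   [i] is [count_mem i l], and the empty partition is [[::]]. *)

Definition is_part (l : seq nat) : bool := sorted geq l && (0%N \notin l).

(* A partition of d has at most d parts, each at most d. *)
Definition partitions (d : nat) : seq (seq nat) :=
  [seq l <- [seq [seq val x | x <- b] | b : {bseq d of 'I_d.+1}]
     | is_part l & sumn l == d].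

Lemma partitions_uniq d : uniq (partitions d).
Proof.
rewrite filter_uniq // map_inj_uniq ?enum_uniq // => b c /inj_map.
by move/(_ val_inj)/val_inj.
Qed.

Lemma mem_partitions d l : (l \in partitions d) = is_part l && (sumn l == d).
Proof.
rewrite mem_filter; apply: andb_idr => /andP[/andP[_ l0] /eqP ld].
have lE x : x \in l -> (0 < x <= d)%N.
  move=> xl; rewrite lt0n -ld; apply/andP; split.
    by apply: contraNneq l0 => <-.
  by rewrite (perm_sumn (perm_to_rem xl)) /= leq_addr.
have sl : (size [seq (inord x : 'I_d.+1) | x <- l] <= d)%N.
  rewrite size_map -ld -sum1_size sumnE !big_seq leq_sum // => x /lE.
  by case/andP.
apply/imageP; exists (Bseq sl) => //=; rewrite -map_comp -[LHS]map_id.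
by apply/eq_in_map => x /lE/andP[_ xd] /=; rewrite inordK.
Qed.

(* The partitions of size at most d, as a finite type. *)
Definition partitions_le (d : nat) : seq (seq nat) :=
  flatten [seq partitions m | m <- iota 0 d.+1].

Definition part_le (d : nat) : finType := seq_sub (partitions_le d).

Definition conj_part (l : seq nat) : seq nat :=
  [seq count (fun x => (j < x)%N) l | j <- iota 0 (head 0%N l)].

(* eta with d - |eta| parts equal to 1 added (meaningful for |eta| <= d). *)
Definition up (d : nat) (eta : seq nat) : seq nat :=
  eta ++ nseq (d - sumn eta) 1%N.

Definition cycle_type (d : nat) (s : 'S_d) : seq nat :=
  sort geq [seq #|C| | C : {set 'I_d} in porbits s].

Definition cycle_class (d : nat) (mu : seq nat) : {set 'S_d} :=
  [set s | cycle_type s == mu].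

(* The Young subgroup S_l of S_d, for l a partition of d: it stabilises each of
   the consecutive blocks of {0, ..., d-1} of lengths l_1, l_2, ... *)
Definition young_set (d : nat) (l : seq nat) : {set 'S_d} :=
  [set s : 'S_d | [forall i, reshape_index l (s i) == reshape_index l i]].

Fact young_group_set d l : group_set (young_set d l).
Proof.
apply/group_setP; split=> [|s t].
  by rewrite inE; apply/forallP => i; rewrite perm1.
rewrite !inE => /forallP sP /forallP tP; apply/forallP => i.
by rewrite permM (eqP (tP _)) (eqP (sP _)).
Qed.
Canonical young (d : nat) (l : seq nat) : {group 'S_d} :=
  Group (young_group_set d l).

Fact sgn_subproof d :
  is_class_fun <<[set: 'S_d]>> [ffun s : 'S_d => (-1) ^+ odd_perm s].
Proof.
rewrite genGid; apply: intro_class_fun => [s t _ _|s]; last by rewrite inE.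
by rewrite odd_permJ.
Qed.
Definition sgn (d : nat) : 'CF([set: 'S_d]) := Cfun 0 (sgn_subproof d).

(* The irreducible character chi^l of S_d, d = |l|, as defined by James and
   Kerber: the common irreducible constituent of the characters induced from
   the trivial character of S_l and from the sign character of S_l', with l'
   conjugate to l (classically there is exactly one). With this convention
   l = (d) gives the trivial character and l = (1^d) the sign. *)
Definition irr_part (d : nat) (l : seq nat) : 'CF([set: 'S_d]) :=
  if [pick i : Iirr [set: 'S_d]
      | (i \in irr_constt ('Ind[[set: 'S_d]] (1 : 'CF(young d l))))
      & (i \in irr_constt ('Ind[[set: 'S_d]]
                             ('Res[young d (conj_part l)] (sgn d))))]
  is Some i then 'chi_i else 0.

(* [repr A] is an element of A. *)
Definition irr_part_val (d : nat) (l mu : seq nat) : algC :=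
  irr_part d l (repr (cycle_class d mu)).

Definition irr_dim (l : seq nat) : algC := irr_part (sumn l) l 1%g.

(* The 0-based index i stands for i + 1; the summands with i > l(lambda)
   vanish. *)
Definition p_shift (k : nat) (l : seq nat) : rat :=
  \sum_(i < size l)
     (((nth 0%N l i)%:R - i.+1%:R + 2%:R^-1) ^+ k
      - (- i.+1%:R + 2%:R^-1) ^+ k).

(* The binomial makes this 0 when |mu| < |eta|, and f_[::] = 1. *)
Definition f_shift (eta mu : seq nat) : algC :=
  'C(sumn mu, sumn eta)%:R * #|cycle_class (sumn eta) eta|%:R
  * irr_part_val (sumn mu) mu (up (sumn mu) eta) / irr_dim mu.

(* kappa k eta are the coefficients of p_k in the basis (f_eta): all but
   finitely many vanish, and p_k = \sum_eta kappa k eta f_eta as functions on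
   partitions. Only the values at partitions eta matter. *)
Definition shifted_coefs (kappa : nat -> seq nat -> rat) : Prop :=
  forall k : nat, (0 < k)%N -> exists D : nat,
    (forall eta, is_part eta -> (D < sumn eta)%N -> kappa k eta = 0) /\
    (forall l, is_part l ->
       ratr (p_shift k l) =
         \sum_(eta : part_le D) ratr (kappa k (val eta)) * f_shift (val eta) l).

Definition hurwitz_count (d s r : nat)
    (eta : 'I_s -> seq nat) (mu : 'I_r -> seq nat) : nat :=
  #|[set w : {ffun 'I_s -> 'S_d} * {ffun 'I_r -> 'S_d} |
      [&& ((\prod_i w.1 i) * (\prod_j w.2 j) == 1)%g,
          [forall i, cycle_type (w.1 i) == up d (eta i)]
        & [forall j, cycle_type (w.2 j) == mu j]]]|.

Definition hurwitz (kappa : nat -> seq nat -> rat) (d s r : nat)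
    (k : s.-tuple nat) (mu : r.-tuple (seq nat)) : rat :=
  (d`!)%:R^-1 *
  \sum_(eta : {ffun 'I_s -> part_le d})
     (\prod_(i < s)
        (kappa (tnth k i) (val (eta i)) / ((tnth k i)`!)%:R
         * 'C(count_mem 1%N (up d (val (eta i))),
              count_mem 1%N (val (eta i)))%:R))
     * (hurwitz_count d (fun i => val (eta i)) (tnth mu))%:R.

Definition hurwitz_m (kappa : nat -> seq nat -> rat) (d m s r : nat)
    (k : s.-tuple nat) (mu : r.-tuple (seq nat)) : rat :=
  \sum_(nu <- partitions d | size nu == m)
     hurwitz kappa d k [tuple of rcons mu nu].

(* prod_i a_i!, with a_i the number of parts equal to i. *)
Definition Aut_part (b : seq nat) : nat :=
  \prod_(i <- undup b) (count_mem i b)`!.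

Definition lowest_degree (n : nat) (P : {mpoly rat[n]}) (e : nat) : Prop :=
  (exists2 m, m \in msupp P & mdeg m = e) /\
  (forall m, m \in msupp P -> (e <= mdeg m)%N).

Definition highest_degree (n : nat) (P : {mpoly rat[n]}) (e : nat) : Prop :=
  (exists2 m, m \in msupp P & mdeg m = e) /\
  (forall m, m \in msupp P -> (mdeg m <= e)%N).

(* Main.v *)
Require Import Defs.
From mathcomp Require Import all_boot all_order all_fingroup all_algebra.
From mathcomp Require Import mpoly.
From mathcomp Require Import all_solvable all_field all_character.
From mathcomp Require Import zify ring.

(** Why the theorem holds.

Write [d] for the sum of the parts and [K] for that of the [k_i]. The last
permutation of each tuple being the identity, the Hurwitz number counts the ways
of writing a long cycle as a product of completed cycles and of a permutation of
cycle type [beta]. A completed cycle acts on an irreducible module of the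
symmetric group by the scalar [p_shift], so that the count becomes a sum over the
irreducible characters that do not vanish on long cycles. These are the
characters of the hooks, the exterior powers of the reflection module, with
generating polynomial
  [\prod_(b <- beta) (1 - 'X^b)] divided by [1 - 'X].
This form of the orthogonality relations is [sum_hook_cf]: the alternating sum of
the hook characters is supported on the long cycles. The point that needs care is
that the irreducible character attached to a hook by its two Young subgroups is
indeed this exterior power ([hook_cf_irr]). Let [E_j] be the exterior power of
degree [j] of the permutation module. Then [E_i] and [E_j] are orthogonal when
[i] and [j] differ by at least two, while [E_a] and [E_(a+1)] are constituents of
the two induced characters that define the character of the hook, whose inner
product is at most 1. The alternating partial sum of the [E_j], which also equals
minus the complementary sum, therefore involves one irreducible character only.

With the sizes of the conjugacy classes ([card_cycle_class]) the quantity times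
the product of the parts becomes ([hurwitz_hook])
  [\sum_(a < d) c_a * F (a + 1/2 - d/2)],
where the [c_a] are the coefficients of the generating polynomial and where, up to
sign, [F u] is the product of the [((u + d/2)^k_i - (u - d/2)^k_i) / k_i!].
Summation against these weights is an iterated central difference, and the central
difference of step [b] is the operator [b * S (b * D) * D], with [D] the derivation
and [S t = sinh (t/2) / (t/2)]. Hence ([hook_sum]) the sum is, up to sign, the
product of the parts times the value at zero of
  [\prod_j S (beta_j * D) / S D] applied to the derivative of order [n - 1] of [F],
which is a polynomial in the parts.

Expanding [F] in powers of [u] and [d], with coefficients of a constant sign, gives
terms of degree [K - r] in [d], for [r] at most [K - s], and the operator adds an
even degree [2 i], where [r = n - 1 + 2 i + 2 j] and [j] is the index of a
coefficient of [1/S]. So all degrees lie between [s] and [K - n + 1]. In degree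
[K - n + 1] only [j = 0] occurs and nothing cancels, by positivity. In degree [s]
only [i = 0] and [r = K - s] occur, so [j = g], and the coefficient of index [g] of
[1/S] is nonzero, for a 2-adic reason ([inv_sinhc]). *)

Set Implicit Arguments.
Unset Strict Implicit.
Unset Printing Implicit Defensive.

Import GRing.Theory Num.Theory Order.TTheory.
Local Open Scope ring_scope.

(** * Cycle types and the sizes of conjugacy classes *)

Section ClassSize.
Import GroupScope.
Local Open Scope nat_scope.

Definition cycle_lengths (T : finType) (s : {perm T}) : seq nat :=
  [seq #|C| | C : {set T} in porbits s].

Lemma count_cycle_lengths (T : finType) (s : {perm T}) (a : pred nat) :
  count a (cycle_lengths s) = \sum_(C in porbits s) a #|C|.
Proof.
rewrite /cycle_lengths count_map -sum1_count big_enum_cond /= big_mkcondr /=.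
by apply: eq_bigr => C _; case: (a _).
Qed.

Lemma cycle_class_lengths d (mu : seq nat) : sorted geq mu ->
  cycle_class d mu = [set s : 'S_d | perm_eq (cycle_lengths s) mu].
Proof.
move=> mu_s; apply/setP => s; rewrite !inE /cycle_type -/(cycle_lengths s).
apply/eqP/idP => [<-|smu]; first by rewrite perm_sym perm_sort.
have geqt : transitive geq by move=> y x z; rewrite /geq => yx /leq_trans; apply.
apply: (@sorted_eq _ geq) => //; first by move=> x y; rewrite /geq /= => /anti_leq.
  by apply: sort_sorted => x y; rewrite /geq /= leq_total.
by rewrite perm_sort.
Qed.

Lemma sub_porbit (T : finType) (s : {perm T}) (A : {set T}) x :
  (forall y, y \in A -> s y \in A) -> x \in A -> porbit s x \subset A.
Proof.
move=> sA xA; apply/subsetP => y /porbitP[i ->].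
elim: i => [|i IH]; first by rewrite perm1.
by rewrite expgSr permM sA.
Qed.

Lemma porbit_step (T : finType) (s : {perm T}) x : porbit s (s x) = porbit s x.
Proof. by have := porbit_perm s 1 x; rewrite expg1. Qed.

Lemma mem_porbitsP (T : finType) (s : {perm T}) C x :
  C \in porbits s -> x \in C -> C = porbit s x.
Proof. by case/imsetP => y _ -> xy; apply/eqP; rewrite eq_sym eq_porbit_mem. Qed.

(** Inserting the new point into the cycle of [y], just before [y]; if [y] is
the new point itself it becomes a fixed point. *)
Definition insert_point d (s : 'S_d) (y : 'I_d.+1) : 'S_d.+1 :=
  lift_perm ord_max ord_max s * tperm ord_max y.

Lemma insert_max d (s : 'S_d) y : insert_point s y ord_max = y.
Proof. by rewrite permM lift_perm_id tpermL. Qed.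

Lemma insert_lift d (s : 'S_d) y u :
  insert_point s y (lift ord_max u) = tperm ord_max y (lift ord_max (s u)).
Proof. by rewrite permM lift_perm_lift. Qed.

Lemma insert_inj d : injective (fun p : 'S_d * 'I_d.+1 => insert_point p.1 p.2).
Proof.
move=> [s y] [t z] /= E.
have yz : y = z by rewrite -(insert_max s y) E insert_max.
subst z; congr (_, _); apply/permP => u.
apply: (@lift_inj _ (ord_max : 'I_d.+1)).
have /permP/(_ (lift ord_max u)) := E.
by rewrite !insert_lift => /perm_inj.
Qed.

(** Every permutation of [d.+1] points arises once, by inserting the last point
into a permutation of the others: this drives the induction on [d] that counts
the permutations of a given cycle type. *)
Lemma insert_bij d : bijective (fun p : 'S_d * 'I_d.+1 => insert_point p.1 p.2).
Proof.
apply: inj_card_bij (@insert_inj d) _.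
by rewrite card_prod !card_Sn card_ord factS mulnC.
Qed.

Lemma porbit_insert_fixed d (s : 'S_d) u :
  porbit (insert_point s ord_max) (lift ord_max u) = lift ord_max @: porbit s u.
Proof.
have E v : insert_point s ord_max (lift ord_max v) = lift ord_max (s v).
  by rewrite insert_lift tperm1 perm1.
apply/eqP; rewrite eqEsubset; apply/andP; split.
  apply: sub_porbit; last by rewrite imset_f // porbit_id.
  move=> _ /imsetP[v vu ->]; rewrite E; apply: imset_f.
  by rewrite -eq_porbit_mem porbit_step eq_porbit_mem.
apply/subsetP => _ /imsetP[v /porbitP[i ->] ->].
elim: i => [|i IH]; first by rewrite perm1 porbit_id.
by rewrite expgSr permM -E -eq_porbit_mem porbit_step eq_porbit_mem.
Qed.

Lemma cycle_lengths_insert_fixed d (s : 'S_d) :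
  perm_eq (cycle_lengths (insert_point s ord_max)) (1 :: cycle_lengths s).
Proof.
apply/seq.permP => a; rewrite /= !count_cycle_lengths.
have max1 : porbit (insert_point s ord_max) ord_max = [set ord_max].
  apply/eqP; rewrite eqEsubset sub1set porbit_id andbT.
  by apply: sub_porbit => [y /set1P ->|]; rewrite ?insert_max set11.
have -> : porbits (insert_point s ord_max)
  = [set ord_max] |: (fun C : {set 'I_d} => lift ord_max @: C) @: porbits s.
  apply/setP => C; rewrite !inE; apply/imsetP/orP => [[x _ ->]|].
    case: (unliftP ord_max x) => [u|] ->; last by rewrite max1 eqxx; left.
    by right; rewrite porbit_insert_fixed; apply/imset_f/imset_f.
  case=> [/eqP ->|/imsetP[_ /imsetP[u _ ->] ->]]; first by exists ord_max.
  by exists (lift ord_max u); rewrite ?porbit_insert_fixed.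
rewrite big_setU1 /=; last first.
  apply/imsetP => -[C _ /setP/(_ ord_max)].
  rewrite set11 => /esym/imsetP[u _ /eqP]; by rewrite (negPf (neq_lift _ _)).
rewrite cards1; congr (_ + _).
rewrite big_imset /=; last by move=> C D _ _ /(imset_inj (@lift_inj _ _)).
by apply: eq_bigr => C _; rewrite card_imset //; apply: lift_inj.
Qed.

(** Forgetting the inserted point identifies it with the point it precedes. *)
Definition collapse d (y : 'I_d) (x : 'I_d.+1) : 'I_d :=
  odflt y (unlift ord_max x).

Lemma collapse_lift d (y u : 'I_d) : collapse y (lift ord_max u) = u.
Proof. by rewrite /collapse liftK. Qed.

Lemma collapse_max d (y : 'I_d) : collapse y ord_max = y.
Proof. by rewrite /collapse unlift_none. Qed.

(** The cycles after insertion are the preimages of the former cycles under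
[collapse], because one step of the new permutation is at most one step of the
old one once the inserted point is forgotten. *)
Lemma porbit_insert_lift d (s : 'S_d) y x :
  porbit (insert_point s (lift ord_max y)) x
  = collapse y @^-1: porbit s (collapse y x).
Proof.
set t := insert_point _ _.
have tmax : t ord_max = lift ord_max y by rewrite insert_max.
have tliftE u : t (lift ord_max u) =
    if s u == y then ord_max else lift ord_max (s u).
  rewrite /t insert_lift; case: eqP => [->|/eqP neq]; first by rewrite tpermR.
  by rewrite tpermD ?neq_lift // (inj_eq (@lift_inj _ _)) eq_sym.
have same z : porbit s (collapse y (t z)) = porbit s (collapse y z).
  case: (unliftP ord_max z) => [u|] ->; last first.
    by rewrite tmax collapse_lift collapse_max.
  rewrite tliftE collapse_lift; case: eqP => [<-|_]; rewrite ?collapse_max.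
    by rewrite porbit_step.
  by rewrite collapse_lift porbit_step.
have toC z : porbit t (lift ord_max (collapse y z)) = porbit t z.
  case: (unliftP ord_max z) => [u|] ->; first by rewrite collapse_lift.
  by rewrite collapse_max -tmax porbit_step.
have tliftS u : porbit t (lift ord_max (s u)) = porbit t (lift ord_max u).
  rewrite -[RHS]porbit_step tliftE; case: eqP => [->|//].
  by rewrite -[LHS](toC) collapse_lift -tmax porbit_step.
apply/eqP; rewrite eqEsubset; apply/andP; split.
  apply: sub_porbit; last by rewrite inE porbit_id.
  by move=> z; rewrite !inE -!eq_porbit_mem same.
apply/subsetP => z; rewrite inE => /porbitP[i Ei].
rewrite -eq_porbit_mem -(toC z) Ei -(toC x); apply/eqP.
elim: i {Ei} => [|i IH]; first by rewrite perm1.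
by rewrite expgSr permM tliftS.
Qed.

Lemma card_collapse d (y : 'I_d) (C : {set 'I_d}) :
  #|collapse y @^-1: C| = #|C| + (y \in C).
Proof.
have -> : collapse y @^-1: C
   = [set x in lift ord_max @: C] :|: [set x | (x == ord_max) && (y \in C)].
  apply/setP => x; rewrite !inE.
  case: (unliftP ord_max x) => [u|] ->.
    rewrite collapse_lift mem_imset; last exact: lift_inj.
    by rewrite eq_sym (negPf (neq_lift _ _)) orbF.
  rewrite collapse_max eqxx /=; case: imsetP => // -[u _ /eqP].
  by rewrite (negPf (neq_lift _ _)).
rewrite cardsU (_ : _ :&: _ = set0) ?cards0 ?subn0; last first.
  apply/setP => x; rewrite !inE; apply/negP => /andP[/imsetP[u _ ->]].
  by rewrite eq_sym (negPf (neq_lift _ _)).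
congr (_ + _); last first.
  case: (y \in C); last by apply: eq_card0 => x; rewrite inE andbF.
  by rewrite /= -(cards1 (ord_max : 'I_d.+1)); apply: eq_card => x; rewrite !inE andbT.
by rewrite -(card_imset C (@lift_inj _ ord_max)); apply: eq_card => x; rewrite inE.
Qed.

Lemma cycle_lengths_insert_lift d (s : 'S_d) (y : 'I_d) :
  perm_eq (cycle_lengths (insert_point s (lift ord_max y)))
    (#|porbit s y|.+1 :: rem #|porbit s y| (cycle_lengths s)).
Proof.
have memy : porbit s y \in porbits s by apply: imset_f.
have mem_len : #|porbit s y| \in cycle_lengths s.
  by apply/imageP; exists (porbit s y).
apply/seq.permP => a.
have := seq.permP (perm_to_rem mem_len) a => /= Ea.
suff E : count a (cycle_lengths (insert_point s (lift ord_max y))) + a #|porbit s y|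
    = a #|porbit s y|.+1 + count a (cycle_lengths s).
  by apply/eqP; rewrite -(eqn_add2r (a #|porbit s y|)) E Ea /= -addnA [_ + a _]addnC.
rewrite !count_cycle_lengths.
have -> : porbits (insert_point s (lift ord_max y))
    = (fun C : {set 'I_d} => collapse y @^-1: C) @: porbits s.
  apply/setP => C; apply/imsetP/imsetP => [[x _ ->]|[_ /imsetP[u _ ->] ->]].
    by exists (porbit s (collapse y x)); [apply: imset_f|apply: porbit_insert_lift].
  by exists (lift ord_max u); rewrite // porbit_insert_lift collapse_lift.
rewrite big_imset /=; last first.
  move=> C D _ _ /setP E; apply/setP => u.
  by have := E (lift ord_max u); rewrite !inE collapse_lift.
rewrite (bigD1 _ memy) [in RHS](bigD1 _ memy) /= card_collapse porbit_id addn1.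
rewrite -!addnA; congr (_ + _); rewrite addnC; congr (_ + _).
apply: eq_bigr => C /andP[CP neC]; rewrite card_collapse.
case: (boolP (y \in C)) => [/(mem_porbitsP CP) E|_]; last by rewrite addn0.
by rewrite E eqxx in neC.
Qed.

(** For a partition this is the order of the centraliser of a permutation of
cycle type [mu]. *)
Definition centraliser_order (mu : seq nat) : nat :=
  (\prod_(i <- mu) i) * Aut_part mu.

(** Any bound on the parts gives the same product, the absent parts having
multiplicity zero; a bound common to two sequences makes them comparable. *)
Lemma Aut_part_sum (mu : seq nat) r : (forall i, i \in mu -> i < r) ->
  Aut_part mu = \prod_(i < r) (count_mem (val i) mu)`!.
Proof.
move=> lt_r; rewrite /Aut_part.
rewrite -(big_mkord xpredT (fun i => (count_mem i mu)`!)).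
rewrite [RHS](bigID (mem mu)) /= [X in _ * X]big1 ?muln1; last first.
  by move=> i /count_memPn ->.
rewrite -[RHS]big_filter; apply: perm_big; apply: uniq_perm.
- exact: undup_uniq.
- by rewrite filter_uniq // iota_uniq.
move=> i; rewrite mem_undup mem_filter mem_index_iota /=.
by case: (boolP (i \in mu)) => // /lt_r ->.
Qed.

Lemma Aut_part_perm mu nu : perm_eq mu nu -> Aut_part mu = Aut_part nu.
Proof.
move=> E; rewrite /Aut_part (perm_big _ (perm_undup (perm_mem E))).
by apply: eq_bigr => i _; have /seq.permP -> := E.
Qed.

Lemma centraliser_order_perm mu nu : perm_eq mu nu ->
  centraliser_order mu = centraliser_order nu.
Proof.
by move=> E; rewrite /centraliser_order (Aut_part_perm E) (perm_big _ E).
Qed.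

Lemma Aut_part_cons i mu :
  Aut_part (i :: mu) = (count_mem i mu).+1 * Aut_part mu.
Proof.
have [r rP] : exists r, forall j, j \in i :: mu -> j < r.
  exists (\max_(j <- i :: mu) j).+1 => j jm.
  by rewrite ltnS leq_bigmax_seq.
have ir : i < r by rewrite rP // mem_head.
rewrite (Aut_part_sum rP) (@Aut_part_sum mu r); last first.
  by move=> j jm; rewrite rP // inE jm orbT.
rewrite (bigD1 (Ordinal ir)) // [in RHS](bigD1 (Ordinal ir)) //= eqxx add1n factS.
rewrite -!mulnA; congr (_ * (_ * _)); apply: eq_bigr => j /negPf neq.
by rewrite eq_sym (_ : (val j == i) = false) // -neq.
Qed.

Lemma centraliser_order_cons i mu :
  centraliser_order (i :: mu)
  = i * (count_mem i mu).+1 * centraliser_order mu.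
Proof. by rewrite /centraliser_order big_cons Aut_part_cons mulnACA. Qed.

Lemma centraliser_order_rem i mu : i \in mu ->
  centraliser_order mu = i * count_mem i mu * centraliser_order (rem i mu).
Proof.
move=> imu; have E := perm_to_rem imu.
rewrite (centraliser_order_perm E) centraliser_order_cons.
by congr (_ * _ * _); have /seq.permP -> := E; rewrite /= eqxx.
Qed.

Definition type_count d (mu : seq nat) : nat :=
  #|[set s : 'S_d | perm_eq (cycle_lengths s) mu]|.

Lemma card_same_length d (s : 'S_d) j :
  #|[set y : 'I_d | #|porbit s y| == j]| = j * count_mem j (cycle_lengths s).
Proof.
rewrite count_cycle_lengths -sum1_card.
rewrite (partition_big (porbit s) (mem (porbits s))) /=; last first.
  by move=> y _; apply: imset_f.
rewrite big_distrr /=; apply: eq_bigr => C CP.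
case: (altP (#|C| =P j)) => [Cj|Cj]; last first.
  rewrite muln0 big1 // => y; rewrite inE => /andP[yj /eqP yC].
  by rewrite -yC yj in Cj.
rewrite muln1 -[in RHS]Cj -sum1_card; apply: eq_bigl => y; rewrite inE.
apply/idP/idP => [/andP[_ /eqP <-]|yC]; first exact: porbit_id.
by rewrite -(mem_porbitsP CP yC) Cj !eqxx.
Qed.

(** Inserting a point before an element of a cycle of length [j] turns a part
[j] into [j.+1]. *)
Lemma perm_eq_bump j (mu nu : seq nat) : j \in nu ->
  perm_eq (j.+1 :: rem j nu) mu
  = (j.+1 \in mu) && perm_eq nu (j :: rem j.+1 mu).
Proof.
move=> jnu; apply/idP/andP => [E|[jmu E]].
  have jmu : j.+1 \in mu by rewrite -(perm_mem E) mem_head.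
  split=> //; rewrite (perm_trans (perm_to_rem jnu)) // perm_cons.
  by rewrite -(perm_cons j.+1) (perm_trans E) // perm_to_rem.
rewrite perm_sym (perm_trans (perm_to_rem jmu)) // perm_cons perm_sym.
by rewrite -(perm_cons j) -(permPr E) perm_sym perm_to_rem.
Qed.

(** Removing the last point either deletes a part 1 or shortens a part [j.+1] to
[j]. Conversely a given part [j] is lengthened by inserting the point before any
of the [j] elements of any of the cycles of length [j]. *)
Lemma type_countS d (mu : seq nat) : 0 \notin mu ->
  type_count d.+1 mu =
  (1 \in mu) * type_count d (rem 1 mu)
  + \sum_(j < d.+1 | (0 < j) && (j.+1 \in mu))
      j * (count_mem (val j) (rem j.+1 mu)).+1
      * type_count d (nat_of_ord j :: rem j.+1 mu).
Proof.
move=> mu0.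
have -> : type_count d.+1 mu
  = \sum_(s : 'S_d) \sum_(y : 'I_d.+1) 
      (perm_eq (cycle_lengths (insert_point s y)) mu : nat).
  rewrite pair_bigA /= /type_count -sum1_card big_mkcond /=.
  rewrite (reindex (fun p : 'S_d * 'I_d.+1 => insert_point p.1 p.2)) /=; last first.
    by apply: onW_bij; apply: insert_bij.
  by apply: eq_bigr => p _; rewrite inE; case: perm_eq.
have tc nu : type_count d nu = \sum_(s : 'S_d) (perm_eq (cycle_lengths s) nu : nat).
  rewrite /type_count -sum1_card big_mkcond; apply: eq_bigr => s _.
  by rewrite inE; case: perm_eq.
rewrite tc big_distrr /=.
under [X in _ + X]eq_bigr => j _ do rewrite tc big_distrr /=.
rewrite [X in _ + X]exchange_big -big_split /=; apply: eq_bigr => s _.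
rewrite big_ord_recr /= addnC; congr (_ + _).
  rewrite (seq.permPl (cycle_lengths_insert_fixed s)).
  case: (boolP (1 \in mu)) => [mu1|mu1]; last first.
    rewrite mul0n; apply/eqP; rewrite eqb0; apply: contra mu1 => /perm_mem <-.
    exact: mem_head.
  by rewrite mul1n (seq.permPr (perm_to_rem mu1)) perm_cons.
have bump y : perm_eq (cycle_lengths (insert_point s (widen_ord (leqnSn d) y))) mu
  = (#|porbit s y|.+1 \in mu)
    && perm_eq (cycle_lengths s) (#|porbit s y| :: rem #|porbit s y|.+1 mu).
  rewrite (_ : widen_ord _ y = lift ord_max y); last first.
    by apply: val_inj; rewrite /= /bump leqNgt ltn_ord.
  rewrite (seq.permPl (cycle_lengths_insert_lift s y)) perm_eq_bump //.
  by apply/imageP; exists (porbit s y) => //; apply: imset_f.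
have ltd y : #|porbit s y| < d.+1.
  by rewrite ltnS -[X in _ <= X](card_ord d) max_card.
under eq_bigr => y _ do rewrite bump.
rewrite (partition_big (fun y => Ordinal (ltd y))
   (fun j : 'I_d.+1 => (0 < j))) /=; last first.
  by move=> y _; rewrite lt0n card_porbit_neq0.
rewrite [RHS]big_mkcondr; apply: eq_bigr => j j0.
rewrite (eq_bigr (fun=> (j.+1 \in mu) && perm_eq (cycle_lengths s)
   (nat_of_ord j :: rem j.+1 mu) : nat)); last first.
  by move=> y /eqP <-.
rewrite sum_nat_const; case: (j.+1 \in mu) => /=; last by rewrite muln0.
case: (boolP (perm_eq _ _)) => [E|_]; last by rewrite !muln0.
rewrite !muln1.
have -> : (count_mem (val j) (rem j.+1 mu)).+1 = count_mem (val j) (cycle_lengths s).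
  by have /seq.permP -> := E; rewrite /= eqxx add1n.
rewrite -card_same_length; apply: eq_card => y; rewrite !inE.
by [].
Qed.

(** Multiplied by the order of the centraliser, the terms of the recursion
[type_countS] become multiples [i * count_mem i mu] of the same factorial, and
these multiplicities add up to the sum of the parts. *)
Lemma type_count_centraliser d (mu : seq nat) : 0 \notin mu -> sumn mu = d ->
  type_count d mu * centraliser_order mu = d`!.
Proof.
elim: d mu => [|d IH] mu mu0 mud.
  have -> : mu = [::].
    case: mu mu0 mud => // i mu; rewrite inE negb_or eq_sym -lt0n => /andP[i0 _] /= /eqP.
    by rewrite addn_eq0 => /andP[/eqP E]; rewrite E in i0.
  rewrite /centraliser_order /Aut_part !big_nil !muln1 /type_count.
  rewrite (_ : [set s | _] = setT) ?cardsT ?card_Sn //.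
  apply/setP => s; rewrite !inE; apply/seq.permP => a.
  rewrite count_cycle_lengths big1 // => C /imsetP[[]//].
have sum_rem i : i \in mu -> i + sumn (rem i mu) = d.+1.
  by move=> /perm_to_rem/perm_sumn /= <-.
rewrite type_countS // mulnDl big_distrl /=.
transitivity (\sum_(i <- undup mu) i * count_mem i mu * d`!).
  have -> : \sum_(i <- undup mu) i * count_mem i mu * d`! =
    \sum_(j < d.+1 | j.+1 \in mu) j.+1 * count_mem j.+1 mu * d`!.
    have lt_mu i : i \in mu -> i < d.+2.
      by move=> /sum_rem <-; rewrite ltnS leq_addr.
    transitivity (\sum_(i < d.+2 | (i : nat) \in mu) i * count_mem (i : nat) mu * d`!).
      rewrite -(big_mkord (fun i => i \in mu) (fun i => i * count_mem i mu * d`!)).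
      rewrite -[RHS]big_filter; apply: perm_big; apply: uniq_perm.
      - exact: undup_uniq.
      - by rewrite filter_uniq // iota_uniq.
      move=> i; rewrite mem_undup mem_filter mem_index_iota /=.
      by case: (boolP (i \in mu)) => // /lt_mu ->.
    by rewrite big_mkcond big_ord_recl /= mul0n mul0n if_same add0n -big_mkcond.
  rewrite [in RHS]big_mkcond big_ord_recl /= [X in _ + X = _]big_mkcond.
  rewrite [X in _ + X = _]big_ord_recl /= add0n; congr (_ + _).
    case: ifP => [mu1|_]; last by rewrite mul0n.
    rewrite [nat_of_bool _]/= mul1n (centraliser_order_rem mu1) !mul1n mulnCA IH //.
      by apply: contra mu0 => /mem_rem.
    by apply/eqP; rewrite -(eqn_add2l 1) sum_rem.
  apply: eq_bigr => j _; rewrite /bump leq0n add1n.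
  case: ifP => [muj|_ //].
  rewrite (centraliser_order_rem muj) -(IH (j.+1 :: rem j.+2 mu)).
  - by rewrite centraliser_order_cons; ring.
  - by rewrite inE negb_or /=; apply: contra mu0 => /mem_rem.
  - by apply/eqP; rewrite /= -(eqn_add2l 1) addnA add1n sum_rem.
rewrite -big_distrl /= factS; congr (_ * _).
rewrite -mud sumnE -[RHS]big_undup_iterop_count /=.
by apply: eq_bigr => i _; rewrite Monoid.iteropE iter_addn_0 mulnC.
Qed.

Lemma card_cycle_class d mu : is_part mu -> sumn mu = d ->
  #|cycle_class d mu| * centraliser_order mu = d`!.
Proof.
by case/andP => mu_s mu0 mud; rewrite cycle_class_lengths // type_count_centraliser.
Qed.

Lemma cycle_class_neq0 d mu : is_part mu -> sumn mu = d ->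
  repr (cycle_class d mu) \in cycle_class d mu.
Proof.
move=> mu_p mud; have [x xC] : exists x, x \in cycle_class d mu.
  apply/set0Pn; rewrite -card_gt0; case: posnP => // C0.
  have := card_cycle_class mu_p mud.
  by rewrite C0 => /esym/eqP; rewrite -leqn0 leqNgt fact_gt0.
exact: mem_repr xC.
Qed.

Lemma up_is_part d eta : is_part eta -> is_part (up d eta).
Proof.
case/andP => eta_s eta0; rewrite /is_part /up mem_cat negb_or eta0 /=.
rewrite mem_nseq andbF andbT.
have geqt : transitive geq by move=> y x z; rewrite /geq => yx /leq_trans; apply.
rewrite sorted_pairwise // pairwise_cat -!sorted_pairwise // eta_s /=.
apply/andP; split; last by case: (_ - _) => //=; elim.
apply/allrelP => i j ieta /nseqP[-> _]; rewrite /geq /= lt0n.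
by apply: contraNneq eta0 => <-.
Qed.

Lemma sumn_up d eta : sumn eta <= d -> sumn (up d eta) = d.
Proof. by move=> le; rewrite /up sumn_cat sumn_nseq mul1n subnKC. Qed.

(** Both sides count the pairs of a permutation of cycle type [up d eta] and a
set of [d - sumn eta] of its fixed points. *)
Lemma card_cycle_class_up d eta : is_part eta -> sumn eta <= d ->
  'C(count_mem 1 (up d eta), count_mem 1 eta) * #|cycle_class d (up d eta)|
  = 'C(d, sumn eta) * #|cycle_class (sumn eta) eta|.
Proof.
move=> eta_p le_d; have Cu := card_cycle_class (up_is_part d eta_p) (sumn_up le_d).
have Ce := card_cycle_class eta_p (erefl _).
set cu := centraliser_order _ in Cu; set ce := centraliser_order _ in Ce.
set m := sumn eta in le_d Ce *; set a := count_mem 1 eta; set r := d - m.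
have cuE : cu * a`! = ce * (a + r)`!.
  have -> : cu = centraliser_order (nseq r 1 ++ eta).
    by apply: centraliser_order_perm; rewrite perm_catC.
  elim: r => [|r IH]; first by rewrite addn0.
  rewrite /= centraliser_order_cons count_cat count_nseq /= !mul1n addnC.
  by rewrite addnS factS -mulnA IH; ring.
have -> : count_mem 1 (up d eta) = a + r.
  by rewrite /up count_cat count_nseq /= mul1n.
have B1 := bin_fact (leq_addr r a); rewrite addKn in B1.
have B2 := bin_fact le_d; rewrite -/r in B2.
have pos : 0 < a`! * r`! * ce * cu.
  have := fact_gt0 d; rewrite -Cu muln_gt0 => /andP[_ cu0].
  have := fact_gt0 m; rewrite -Ce muln_gt0 => /andP[_ ce0].
  by rewrite muln_gt0 cu0 muln_gt0 ce0 muln_gt0 !fact_gt0.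
apply/eqP; rewrite -(eqn_pmul2r pos); apply/eqP.
transitivity (d`! * (ce * (a + r)`!)); first by rewrite -B1 -Cu; ring.
by rewrite -cuE -B2 -Ce; ring.
Qed.

End ClassSize.

(** * Exterior powers of the permutation module *)

Section ExteriorPowers.
Import GroupScope GRing.Theory Num.Theory.
Local Open Scope ring_scope.

Variable T : finType.
Implicit Types (A B C : {set T}) (s t : {perm T}).

Lemma setwise_stabP A s :
  reflect (forall x, x \in A -> s x \in A) (s \in 'N(A | 'P)).
Proof.
apply: (iffP astabsP) => [sA x xA|sA x].
  by have := sA x; rewrite /= /aperm xA.
rewrite /= /aperm; have E : s @: A = A.
  apply/eqP; rewrite eqEcard card_imset ?leqnn ?andbT; last exact: perm_inj.
  by apply/subsetP => _ /imsetP[y yA ->]; apply: sA.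
by rewrite -{1}E mem_imset //; apply: perm_inj.
Qed.

Lemma setwise_stab_porbit A s x :
  s \in 'N(A | 'P) -> x \in A -> porbit s x \subset A.
Proof. by move/setwise_stabP => sA xA; apply: sub_porbit. Qed.

Lemma porbits_restr_perm A s : s \in 'N(A | 'P) ->
  porbits (restr_perm A s)
  = [set C in porbits s | C \subset A] :|: (set1 @: ~: A).
Proof.
move=> sA; set r := restr_perm A s.
have inA x : x \in A -> porbit r x = porbit s x.
  move=> xA.
  have pw i : (r ^+ i)%g x = (s ^+ i)%g x /\ (s ^+ i)%g x \in A.
    elim: i => [|i [IH iA]]; first by rewrite !perm1.
    rewrite !expgSr !permM IH /r restr_permE //; split=> //.
    by apply: (setwise_stabP A s sA).
  by apply/setP => y; apply/porbitP/porbitP => -[i ->]; exists i; case: (pw i).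
have outA x : x \notin A -> porbit r x = [set x].
  move=> xA; apply/eqP; rewrite eqEsubset sub1set porbit_id andbT.
  apply: sub_porbit => [y /set1P ->|]; last exact: set11.
  by rewrite (out_perm (restr_perm_on A s)) // set11.
apply/setP => C; rewrite !inE; apply/imsetP/orP => [[x _ ->]|].
  case: (boolP (x \in A)) => xA; [left|right].
    by rewrite inA // imset_f //= setwise_stab_porbit.
  by rewrite outA // imset_f // inE.
case=> [/andP[/imsetP[x _ ->] xA]|/imsetP[x]].
  by exists x; rewrite ?inA // (subsetP xA) // porbit_id.
by rewrite inE => xA ->; exists x; rewrite ?outA.
Qed.

(** The cycles of the restriction are those contained in [A] and the fixed points
outside [A]. *)
Lemma odd_restr_perm A s : s \in 'N(A | 'P) ->
  odd_perm (restr_perm A s)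
  = odd (#|A| + #|[set C in porbits s | C \subset A]|) :> bool.
Proof.
move=> sA; rewrite /odd_perm porbits_restr_perm // cardsU.
rewrite (_ : _ :&: _ = set0) ?cards0 ?subn0; last first.
  apply/setP => C; rewrite !inE; apply/negP => /andP[/andP[_ CA] /imsetP[x]].
  by rewrite inE => /negP xA CE; apply: xA; rewrite (subsetP CA) // CE set11.
rewrite card_imset; last exact: set1_inj.
by rewrite -(cardsC A) !oddD; case: odd; case: odd; case: odd.
Qed.

(** The diagonal coefficient of [s] at the wedge product of the basis vectors
indexed by [A], in an exterior power of the permutation module. *)
Definition ext_sign A s : algC :=
  (s \in 'N(A | 'P))%:R * (-1) ^+ restr_perm A s.

(** The trace on the exterior power of degree [a] of the permutation module. *)
Definition ext_char (a : nat) s : algC := \sum_(A : {set T} | #|A| == a) ext_sign A s.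

Lemma stable_cover s (S : {set {set T}}) :
  S \subset porbits s -> s \in 'N(cover S | 'P).
Proof.
move=> sub; apply/setwise_stabP => x /bigcupP[C CS xC].
apply/bigcupP; exists C => //.
have CP := subsetP sub _ CS; rewrite (mem_porbitsP CP xC).
by rewrite -eq_porbit_mem porbit_step.
Qed.

Lemma porbits_sub_cover s (S : {set {set T}}) :
  S \subset porbits s -> [set C in porbits s | C \subset cover S] = S.
Proof.
move=> sub; apply/setP => C; rewrite inE; apply/andP/idP => [[CP CS]|CS].
  case/imsetP: (CP) => x _ E; have xC : x \in C by rewrite E porbit_id.
  have /bigcupP[D DS xD] := subsetP CS _ xC.
  by rewrite (mem_porbitsP CP xC) -(mem_porbitsP (subsetP sub _ DS) xD).
by rewrite (subsetP sub) // bigcup_sup.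
Qed.

Lemma cover_porbits_sub s A : s \in 'N(A | 'P) ->
  cover [set C in porbits s | C \subset A] = A.
Proof.
move=> sA; apply/eqP; rewrite eqEsubset; apply/andP; split.
  by apply/bigcupsP => C; rewrite inE => /andP[].
apply/subsetP => x xA; apply/bigcupP; exists (porbit s x); last exact: porbit_id.
by rewrite inE imset_f //= setwise_stab_porbit.
Qed.

Lemma trivIset_porbits s : trivIset (porbits s).
Proof.
apply/trivIsetP => C D CP DP; apply: contraNT.
rewrite -setI_eq0 => /set0Pn[x /setIP[xC xD]].
by rewrite (mem_porbitsP CP xC) -(mem_porbitsP DP xD).
Qed.

(** This is the determinant of [1 + 'X * s] on the permutation module. The stable
subsets are the unions of cycles, so the product over the cycles expands into a
sum over the stable subsets. *)
Lemma ext_char_poly s :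
  \sum_(A : {set T}) ext_sign A s *: 'X^#|A| = \prod_(C in porbits s) (1 - (- 'X) ^+ #|C|).
Proof.
pose f C : {poly algC} := if C \in porbits s then - (- 'X) ^+ #|C| else 0.
transitivity (\prod_(C : {set T}) (f C + 1)); last first.
  rewrite [RHS]big_mkcond; apply: eq_bigr => C _; rewrite /f.
  by case: ifP => _; rewrite ?add0r // addrC.
rewrite (@bigA_distr _ _ _ _ _ _ f (fun=> 1)) /=.
rewrite (bigID (fun S : {set {set T}} => S \subset porbits s)) /=.
rewrite [X in _ = _ + X]big1 ?addr0; last first.
  move=> S /subsetPn[C CS CP]; rewrite (bigD1 C) //= CS /f (negPf CP).
  by rewrite mul0r.
rewrite (bigID (fun A : {set T} => s \in 'N(A | 'P))) /= [X in _ + X]big1 ?addr0; last first.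
  by move=> A /negPf sA; rewrite /ext_sign sA mul0r scale0r.
rewrite (reindex_onto (fun S : {set {set T}} => cover S)
   (fun A : {set T} => [set C in porbits s | C \subset A])) /=; last first.
  by move=> A sA; apply: cover_porbits_sub.
rewrite [LHS](eq_bigl (fun S : {set {set T}} => S \subset porbits s)); last first.
  move=> S; apply/andP/idP => [[_ /eqP <-]|sub].
    by apply/subsetP => C; rewrite inE => /andP[].
  by rewrite stable_cover // porbits_sub_cover.
apply: eq_bigr => S sub; rewrite /ext_sign stable_cover // mul1r.
rewrite odd_restr_perm ?stable_cover // porbits_sub_cover // signr_odd.
rewrite -big_mkcond /=.
rewrite [RHS](eq_bigr (fun C : {set T} => -1 * (-1 * 'X) ^+ #|C|)); last first.
  by move=> C CS; rewrite /f (subsetP sub) // !mulN1r.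
have triv : trivIset S by apply: trivIsetS sub (trivIset_porbits s).
rewrite big_split /= prodr_const.
under [X in _ = _ * X]eq_bigr => C _ do rewrite exprMn.
rewrite big_split /= -!expr_sum (eqP triv) mulrA -exprD addnC.
by rewrite -mul_polyC rmorphXn rmorphN1.
Qed.

End ExteriorPowers.

Section ExtSign.
Import GroupScope GRing.Theory Num.Theory.
Local Open Scope ring_scope.

Variable T : finType.
Implicit Types (A B C : {set T}) (s t y : {perm T}).

Lemma ext_signM A s t : s \in 'N(A | 'P) ->
  ext_sign A (s * t)%g = ext_sign A s * ext_sign A t.
Proof.
move=> sA; rewrite /ext_sign groupMl // sA mul1r.
case: (boolP (t \in _)) => tA; last by rewrite !mul0r mulr0.
by rewrite !mul1r morphM // odd_permM signr_addb.
Qed.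

Lemma ext_sign_perm_on A s : perm_on A s -> ext_sign A s = (-1) ^+ odd_perm s.
Proof.
move=> As; have sA : s \in 'N(A | 'P).
  by apply/setwise_stabP => x xA; rewrite perm_closed.
rewrite /ext_sign sA mul1r; congr (_ ^+ odd_perm _); apply/permP => x.
case: (boolP (x \in A)) => xA; first by rewrite restr_permE.
by rewrite (out_perm (restr_perm_on _ _)) // (out_perm As).
Qed.

Lemma ext_sign_fix A s : (forall x, x \in A -> s x = x) -> ext_sign A s = 1.
Proof.
move=> fixA; have sA : s \in 'N(A | 'P).
  by apply/setwise_stabP => x xA; rewrite fixA.
rewrite /ext_sign sA mul1r (_ : restr_perm A s = 1%g) ?odd_perm1 //.
apply/permP => x; rewrite perm1; case: (boolP (x \in A)) => xA.
  by rewrite restr_permE // fixA.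
by rewrite (out_perm (restr_perm_on _ _)).
Qed.

Lemma ext_sign1 A : ext_sign A 1 = 1.
Proof. by apply: ext_sign_fix => x _; rewrite perm1. Qed.

(** A transposition negates the line of [A] if it moves two points of [A], and
fixes it if it moves no point of [A]; all the vanishing results below come from
this contrast. *)
Lemma ext_sign_tperm A (x y : T) : x \in A -> y \in A -> x != y ->
  ext_sign A (tperm x y) = -1.
Proof.
move=> xA yA neq; rewrite ext_sign_perm_on ?odd_tperm ?neq //.
apply: subset_trans (tperm_on x y) _.
by apply/subsetP => z /set2P[] ->.
Qed.

Lemma ext_sign_tperm_out A (x y : T) : x \notin A -> y \notin A ->
  ext_sign A (tperm x y) = 1.
Proof.
move=> xA yA; apply: ext_sign_fix => z zA.
by rewrite tpermD //; [apply: contraNneq xA|apply: contraNneq yA] => ->.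
Qed.

Lemma tperm_stab A (x y : T) : (x \in A) = (y \in A) -> tperm x y \in 'N(A | 'P).
Proof. by move=> E; apply/setwise_stabP => z; case: tpermP => // ->; rewrite E. Qed.

Lemma setwise_stabJ A s y :
  ((s ^ y)%g \in 'N(A | 'P)) = (s \in 'N(y @^-1: A | 'P)).
Proof.
apply/setwise_stabP/setwise_stabP => sA x.
  by rewrite !inE => xA; rewrite -permJ; apply: sA.
move=> xA; have := sA (y^-1%g x); rewrite !inE permKV => /(_ xA).
by rewrite -permJ permKV.
Qed.

Lemma restr_permJ A s y : s \in 'N(y @^-1: A | 'P) ->
  restr_perm A (s ^ y)%g = (restr_perm (y @^-1: A) s ^ y)%g.
Proof.
move=> sA; have sJ : (s ^ y)%g \in 'N(A | 'P) by rewrite setwise_stabJ.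
apply/permP => x; rewrite -(permKV y x); move: (y^-1%g x) => {}x.
rewrite permJ; case: (boolP (y x \in A)) => xA.
  rewrite restr_permE // restr_permE //; first by rewrite permJ.
  by rewrite inE.
by rewrite !(out_perm (restr_perm_on _ _)) ?inE.
Qed.

Lemma ext_signJ A s y : ext_sign A (s ^ y)%g = ext_sign (y @^-1: A) s.
Proof.
rewrite /ext_sign setwise_stabJ.
case: (boolP (s \in _)) => sA; last by rewrite !mul0r.
by rewrite restr_permJ // odd_permJ.
Qed.

(** List each set followed by its complement, and match the two lists position by
position. *)
Lemma card_eq_preim A B : #|A| = #|B| -> exists y : {perm T}, y @^-1: A = B.
Proof.
move=> AB; pose e C := enum C ++ enum (~: C).
have e_uniq C : uniq (e C).
  rewrite cat_uniq !enum_uniq andbT /=; apply/hasPn => z.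
  by rewrite !mem_enum inE.
have e_mem C z : z \in e C.
  by rewrite mem_cat !mem_enum inE; case: (z \in C).
have e_size C : size (e C) = #|T| by rewrite size_cat -!cardE cardsC.
have f_inj : injective (fun z => nth z (e A) (index z (e B))).
  move=> z w /= E.
  have lt u : (index u (e B) < size (e A))%N by rewrite e_size -(e_size B) index_mem.
  rewrite (set_nth_default w) // in E.
  have := (elimT (uniqP w) (e_uniq A)) _ _ (lt z) (lt w) E.
  by move/(congr1 (nth w (e B))); rewrite !nth_index.
exists (perm f_inj); apply/setP => z; rewrite inE permE /=.
have ABC : #|~: A| = #|~: B|.
  by apply/eqP; rewrite -(eqn_add2l #|A|) cardsC AB cardsC.
have iB u C : u \in C -> (index u (enum C) < #|C|)%N.
  by move=> uC; rewrite cardE index_mem mem_enum.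
rewrite /e nth_cat index_cat mem_enum -!cardE AB.
case: (boolP (z \in B)) => zB; first by rewrite iB // -mem_enum mem_nth // -cardE AB iB.
rewrite ltnNge leq_addr /= addKn; apply/negbTE.
by rewrite -in_setC -mem_enum mem_nth // -cardE ABC iB // inE.
Qed.

(** The permutations that carry one set to another form a coset of the setwise
stabiliser. *)
Lemma card_preim_eq A B : #|A| = #|B| ->
  #|[set y : {perm T} | y @^-1: A == B]| = #|'N(A | 'P)|.
Proof.
case/card_eq_preim => y0 y0P.
rewrite -[RHS](card_imset _ (mulgI y0)); apply: eq_card => y.
have [z ->] : exists z, y = (y0 * z)%g by exists (y0^-1 * y)%g; rewrite mulKVg.
rewrite mem_imset; last exact: mulgI.
rewrite [LHS]inE -y0P; apply/idP/idP => [/eqP/setP E|zA]; last apply/eqP.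
  apply/setwise_stabP => x xA.
  by have := E (y0^-1%g x); rewrite !inE !permM permKV xA.
apply/setP => x; rewrite !inE permM.
exact: (astabsP zA).
Qed.

End ExtSign.

Section Induced.
Import GroupScope GRing.Theory Num.Theory.
Local Open Scope ring_scope.

Variable d : nat.
Local Notation G := [set: 'S_d].
Implicit Types (A B C : {set 'I_d}) (s t y : 'S_d).

Fact lin_ext_subproof A :
  is_class_fun <<'N(A | 'P)%G>> [ffun s : 'S_d => ext_sign A s].
Proof.
rewrite genGid; apply: intro_class_fun => [s t sA tA|s sA]; last first.
  by rewrite /ext_sign (negPf sA) mul0r.
by rewrite conjgE !ext_signM ?groupV ?groupM // mulrCA -ext_signM ?groupV // mulVg
  ext_sign1 mulr1.
Qed.
Definition lin_ext A : 'CF('N(A | 'P)%G) := Cfun 0 (lin_ext_subproof A).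

Lemma lin_extE A s : lin_ext A s = ext_sign A s.
Proof. by rewrite cfunE. Qed.

Lemma lin_ext_lin A : lin_ext A \is a linear_char.
Proof.
pose r (s : 'S_d) : 'M[algC]_1 := (ext_sign A s)%:M.
have rP : mx_repr 'N(A | 'P)%G r.
  split=> [|s t sA tA]; first by rewrite /r ext_sign1.
  by rewrite /r ext_signM // -scalar_mxM.
rewrite qualifE /= lin_extE ext_sign1 eqxx andbT.
have -> : lin_ext A = cfRepr (MxRepresentation rP).
  apply/cfun_inP => s sA; rewrite lin_extE cfunE sA mulr1n /=.
  by rewrite /r mxtrace_scalar.
exact: cfRepr_char.
Qed.

Lemma sgnE s : sgn d s = (-1) ^+ odd_perm s.
Proof. by rewrite cfunE. Qed.

Lemma sgn_lin : sgn d \is a linear_char.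
Proof.
pose r (s : 'S_d) : 'M[algC]_1 := ((-1) ^+ odd_perm s)%:M.
have rP : mx_repr G r.
  split=> [|s t sA tA]; first by rewrite /r odd_perm1.
  by rewrite /r odd_permM signr_addb -scalar_mxM.
rewrite qualifE /= sgnE odd_perm1 eqxx andbT.
have -> : sgn d = cfRepr (MxRepresentation rP).
  apply/cfun_inP => s sA; rewrite sgnE cfunE sA mulr1n /=.
  by rewrite /r mxtrace_scalar.
exact: cfRepr_char.
Qed.

(** The exterior power is the sum of the lines indexed by the sets of a given
size, which are permuted transitively. Hence [ext_char] is a character, and it
can be compared with characters induced from Young subgroups. *)
Lemma Ind_lin_ext A s : 'Ind[G] (lin_ext A) s = ext_char #|A| s.
Proof.
rewrite cfIndE ?subsetT //.
under eq_bigr => y _ do rewrite lin_extE ext_signJ.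
rewrite (partition_big (fun y : 'S_d => y @^-1: A) (fun B => #|B| == #|A|)) /=; last first.
  move=> y _; apply/eqP; rewrite -(card_imset _ (@perm_inj _ y)).
  apply: eq_card => x; rewrite -(permKV y x) mem_imset ?inE //.
  exact: perm_inj.
rewrite mulr_sumr; apply: eq_bigr => B /eqP AB.
rewrite (eq_bigr (fun=> ext_sign B s)); last by move=> y /andP[_ /eqP ->].
rewrite sumr_const -(card_preim_eq (esym AB)).
have -> : #|[pred y : 'S_d | y \in G & y @^-1: A == B]|
  = #|[set y : 'S_d | y @^-1: A == B]| by apply: eq_card => y; rewrite !inE.
rewrite -[ext_sign B s *+ _]mulr_natl mulKf // pnatr_eq0 card_preim_eq //.
by rewrite -lt0n cardG_gt0.
Qed.

Definition ext_cf a : 'CF(G) := 'Ind[G] (lin_ext [set x : 'I_d | (x < a)%N]).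

Lemma card_ord_lt a : (a <= d)%N -> #|[set x : 'I_d | (x < a)%N]| = a.
Proof.
move=> ad; rewrite -sum1_card (eq_bigl (fun x : 'I_d => (x < a)%N)); last first.
  by move=> x; rewrite inE.
by rewrite (big_ord_narrow ad) /= sum1_card card_ord.
Qed.

End Induced.

(** * Orthogonality, and the Young subgroups of a hook *)

Section Orthogonality.
Import GroupScope GRing.Theory Num.Theory Order.TTheory.
Local Open Scope ring_scope.

Variable d : nat.
Local Notation G := [set: 'S_d].
Implicit Types (A B C : {set 'I_d}) (s t y : 'S_d).

Lemma ext_cfE a s : (a <= d)%N -> ext_cf d a s = ext_char a s.
Proof. by move=> ad; rewrite /ext_cf Ind_lin_ext card_ord_lt. Qed.

Lemma Ind_lin_ext_cf A : 'Ind[G] (lin_ext A) = ext_cf d #|A|.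
Proof.
apply/cfunP => s; rewrite Ind_lin_ext ext_cfE //.
by rewrite -[X in (_ <= X)%N](card_ord d) max_card.
Qed.

Lemma ext_cf_char a : ext_cf d a \is a character.
Proof. by rewrite cfInd_char ?lin_charW ?lin_ext_lin. Qed.

Lemma sum_negated (H : {group 'S_d}) (t : 'S_d) (F : 'S_d -> algC) : t \in H ->
  (forall s, s \in H -> F (t * s)%g = - F s) -> \sum_(s in H) F s = 0.
Proof.
move=> tH Ft; have E : \sum_(s in H) F s = - \sum_(s in H) F s.
  rewrite {1}(reindex_inj (mulgI t)) /= -sumrN.
  by apply: eq_big => s; [rewrite groupMl|rewrite groupMl // => /Ft].
apply/eqP; have := mulrn_eq0 (\sum_(s in H) F s) 2.
by rewrite mulr2n {1}E addNr eqxx => /esym.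
Qed.

(** For sets [A] and [B] of sizes [a] and [b], two points of [B] outside [A] give
a transposition that fixes the line of [A] and negates that of [B], so the
contribution of the pair cancels. *)
Lemma ext_cf_ortho a b : (a.+1 < b <= d)%N -> '[ext_cf d a, ext_cf d b] = 0.
Proof.
case/andP => ab bd; have ad : (a <= d)%N by rewrite (leq_trans _ bd) // ltnW // ltnW.
rewrite cfdotE; under eq_bigr => s _.
  rewrite !ext_cfE // /ext_char rmorph_sum big_distrlr /=; over.
rewrite exchange_big /= big1 ?mulr0 // => A /eqP Aa.
rewrite exchange_big /= big1 // => B /eqP Bb.
have [x [y [/setDP[xB xA] /setDP[yB yA] neq]]] :
    exists x, exists y : 'I_d, [/\ x \in B :\: A, y \in B :\: A & x != y].
  apply/card_gt1P; rewrite cardsD ltn_subRL.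
  rewrite Bb; apply: leq_ltn_trans ab.
  by rewrite addn1 ltnS -Aa subset_leq_card // subsetIr.
apply: (@sum_negated [set: 'S_d]%G (tperm x y)); rewrite ?inE // => s _.
rewrite !ext_signM ?tperm_stab ?(negPf xA) ?(negPf yA) ?xB ?yB //.
by rewrite (ext_sign_tperm_out xA yA) (ext_sign_tperm xB yB neq) mul1r mulN1r rmorphN mulrN.
Qed.

(** [K] and [L] are the Young subgroups of a hook and of its conjugate: the
symmetric groups of two sets whose sizes add up to [d.+1]. *)
Section Hook.

Variables (K L : {group 'S_d}) (A B : {set 'I_d}).
Hypothesis KP : forall s, (s \in K) = perm_on A s.
Hypothesis LP : forall s, (s \in L) = perm_on B s.
Hypothesis cardAB : (#|A| + #|B| = d.+1)%N.

(* The double cosets on which the trivial character of K and the sign character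
   of L agree; they turn out to form a single one. *)
Let good : {set 'S_d} := [set y : 'S_d | #|[set u in B | y u \in A]| <= 1]%N.

Lemma tperm_perm_on (C : {set 'I_d}) (x y : 'I_d) :
  x \in C -> y \in C -> perm_on C (tperm x y).
Proof.
move=> xC yC; apply: subset_trans (tperm_on x y) _.
by apply/subsetP => z /set2P[] ->.
Qed.

(** If [y] carries two points of [B] into [A], the transposition of these points
lies in both groups and cancels the sum; otherwise the groups meet trivially. *)
Lemma signed_sum_double_coset (y : 'S_d) :
  \sum_(x in L) ((x ^ y)%g \in K)%:R * (-1) ^+ odd_perm x = (y \in good)%:R :> algC.
Proof.
case: (boolP (y \in good)); rewrite inE.
  move=> le1; rewrite (bigD1 1%g) ?group1 //= conj1g group1 odd_perm1 mulr1.
  rewrite big1 ?addr0 // => x /andP[xL x1].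
  rewrite KP; case: (boolP (perm_on _ _)) => xK; last by rewrite mul0r.
  case/eqP: x1; apply/permP => u; rewrite perm1; apply/eqP.
  apply: contraT => xu.
  have mv w : x w != w -> w \in [set u in B | y u \in A].
    move=> xw; rewrite inE; apply/andP; split.
      by rewrite LP in xL; apply: contraR xw => wB; rewrite (out_perm xL).
    apply: contraR xw => wA; have := out_perm xK wA.
    by rewrite permJ => /perm_inj ->.
  have := card_le1_eqP le1 u (x u) (mv _ xu).
  rewrite mv ?(inj_eq perm_inj) // => /(_ isT) E.
  by rewrite E eqxx in xu.
rewrite -ltnNge => /card_gt1P[u [v []]].
rewrite !inE => /andP[uB uA] /andP[vB vA] neq.
apply: (@sum_negated L (tperm u v)); first by rewrite LP tperm_perm_on.
move=> s _; rewrite conjMg tpermJ groupMl ?KP ?tperm_perm_on //.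
by rewrite odd_permM odd_tperm neq signr_addb mulN1r mulrN.
Qed.

(** Of the [#|B|] points of [B], all but at most one are sent to the complement of
[A], which has [#|B|.-1] points: so its preimage is [B] minus one point. *)
Lemma good_preim y : y \in good ->
  y @^-1: (~: A) \subset B /\ (#|B| = #|y @^-1: (~: A)|.+1)%N.
Proof.
rewrite inE => le1.
have cA : #|y @^-1: (~: A)| = #|~: A|.
  rewrite -(card_imset _ (@perm_inj _ y)); apply: eq_card => x.
  by rewrite -(permKV y x) mem_imset ?inE //; apply: perm_inj.
have cB : (#|B| = #|~: A|.+1)%N.
  by apply/eqP; rewrite -(eqn_add2l #|A|) cardAB addnS cardsC card_ord.
split; last by rewrite cA.
suff -> : y @^-1: (~: A) = B :\: [set u in B | y u \in A] by apply: subsetDl.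
apply/esym/eqP; rewrite eqEcard; apply/andP; split.
  by apply/subsetP => u; rewrite !inE => /andP[/nandP[] h uB] //; rewrite uB in h.
rewrite cA cardsD (setIidPr _); last by apply/subsetP => u; rewrite inE => /andP[].
by rewrite cB; case: #|_| le1 => [|[|]] // _; rewrite ?subn0 ?subn1 //= leqnSn.
Qed.

Lemma good_double_coset y y' : y \in good -> y' \in good ->
  exists2 l, l \in L & exists2 k, k \in K & y' = (l * y * k)%g.
Proof.
move=> /good_preim[WB cW] /good_preim[WB' cW'].
set W := y @^-1: _ in WB cW; set W' := y' @^-1: _ in WB' cW'.
have pick1 (V : {set 'I_d}) : V \subset B -> (#|B| = #|V|.+1)%N ->
    exists u, u \in B /\ V = B :\ u.
  move=> VB cV; have /cards1P[u E] : #|B :\: V| == 1%N.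
    by rewrite cardsD (setIidPr VB) cV subSn // subnn.
  exists u; split; last by rewrite -E setDDr setDv set0U (setIidPr VB).
  by have := set11 u; rewrite -E => /setDP[].
have [u [uB EW]] := pick1 _ WB cW; have [u' [uB' EW']] := pick1 _ WB' cW'.
(* h carries W to W' and t carries W' back to W inside B, so h * t restricts to
   a permutation of W; undoing t extends the bijection from W to W' to an
   element of L. *)
pose h := (y * y'^-1)%g; pose t := tperm u u'.
have hW w : w \in W -> h w \in W'.
  by rewrite !inE permM permKV.
have tW w : w \in W' -> t w \in W.
  rewrite EW EW' => /setD1P[neq wB]; rewrite /t.
  case: tpermP => [E|E|/eqP ne1 /eqP ne2].
  - by rewrite !inE uB' andbT; apply: contra neq => /eqP ->; rewrite E.
  - by rewrite E eqxx in neq.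
  - by rewrite !inE ne1.
have htW : (h * t)%g \in 'N(W | 'P).
  by apply/setwise_stabP => w wW; rewrite permM tW // hW.
pose p := (restr_perm W (h * t) * t)%g.
have pL : p \in L.
  rewrite groupM // LP; last by rewrite tperm_perm_on.
  exact: subset_trans (restr_perm_on _ _) WB.
have pW w : w \in W -> p w = h w.
  by move=> wW; rewrite permM restr_permE // permM tpermK.
move: p pL pW => p pL pW; exists p^-1%g; rewrite ?groupV //.
exists (y^-1 * p * y')%g; last first.
  by rewrite -!mulgA mulKVg mulKg.
rewrite KP; apply/subsetP => z; apply: contraR => zA.
rewrite !permM pW; last by rewrite !inE permKV.
by rewrite permM !permKV.
Qed.

Lemma card_good : (#|good| <= #|L| * #|K|)%N.
Proof.
have [->|[y yg]] := set_0Vmem good; first by rewrite cards0.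
rewrite -cardsX; apply: leq_trans (leq_imset_card (fun p => p.1 * y * p.2)%g _).
apply/subset_leq_card/subsetP => y' yg'.
have [l lL [k kK ->]] := good_double_coset yg yg'.
by apply/imsetP; exists (l, k); rewrite ?inE ?lL.
Qed.

(** By Frobenius reciprocity the inner product counts [good], normalised by the
orders of the two groups, and a double coset has at most [#|L| * #|K|]
elements. *)
Lemma cfdot_young_hook :
  '['Ind[G] (1 : 'CF(K)), 'Ind[G] ('Res[L] (sgn d))] <= 1.
Proof.
rewrite -cfdot_Res_l cfdotE.
have -> : \sum_(x in L) ('Res[L] ('Ind[G] (1 : 'CF(K)))) x * ('Res[L] (sgn d) x)^*
  = #|K|%:R^-1 * #|good|%:R.
  under eq_bigr => x xL.
    rewrite !cfResE ?subsetT // sgnE rmorph_sign cfIndE ?subsetT //.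
    under eq_bigr => y _ do rewrite cfun1E.
    rewrite -mulrA mulr_suml; over.
  rewrite -mulr_sumr exchange_big /=; congr (_ * _).
  rewrite -sum1_card natr_sum [RHS]big_mkcond /=.
  apply: eq_big => [y|y _]; first by rewrite inE.
  by rewrite signed_sum_double_coset; case: (y \in good).
rewrite mulrA -invfM -natrM mulrC ler_pdivrMr ?mul1r ?ler_nat ?card_good //.
by rewrite ltr0n muln_gt0 !cardG_gt0.
Qed.

End Hook.

(** Two distinct common constituents would contribute at least 2 to the inner
product. *)
Lemma common_constt_uniq (phi psi : 'CF(G)) i j :
  phi \is a character -> psi \is a character -> '[phi, psi] <= 1 ->
  i \in irr_constt phi -> i \in irr_constt psi ->
  j \in irr_constt phi -> j \in irr_constt psi -> i = j.
Proof.
move=> phiC psiC le1 iphi ipsi jphi jpsi; apply/eqP; apply: contraT => neq.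
have ge1 (chi : 'CF(G)) (k : Iirr G) :
    chi \is a character -> k \in irr_constt chi -> 1 <= '[chi, 'chi_k].
  move=> chiC kchi; have /natrP[n nE] := Cnat_cfdot_char_irr k chiC.
  by move: kchi; rewrite irr_consttE nE pnatr_eq0 -lt0n ler1n.
suff /lt_geF : 1 < '[phi, psi] by rewrite le1.
rewrite cfdot_char_r // (bigD1 i) //= (bigD1 j) ?(eq_sym j) //= addrA.
apply: lt_le_trans (_ : 1 + 1 <= _); first by rewrite ltrDl ltr01.
rewrite -[1 + 1]addr0; apply: lerD.
  by apply: lerD; rewrite -[1]mulr1 ler_pM // ge1.
by apply: sumr_ge0 => k _; rewrite mulr_ge0 // natr_ge0 // Cnat_cfdot_char_irr.
Qed.

Lemma not_ortho_common_constt (phi psi : 'CF(G)) i :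
  phi \is a character -> psi \is a character ->
  i \in irr_constt phi -> i \in irr_constt psi -> '[phi, psi] != 0.
Proof.
move=> phiC psiC iphi ipsi; apply/eqP => E.
have /eqP := constt_ortho_char phiC psiC iphi ipsi E.
by rewrite cfnorm_irr oner_eq0.
Qed.

End Orthogonality.

(** * The irreducible characters of hooks *)

Section HookShape.
Import GroupScope.
Local Open Scope nat_scope.

Definition hook (d a : nat) : seq nat := (d - a) :: nseq a 1.

Lemma hook_is_part d a : a < d -> is_part (hook d a).
Proof.
move=> ad; rewrite /is_part /hook inE negb_or mem_nseq andbF andbT.
have m0 : 0 < d - a by rewrite subn_gt0.
rewrite eq_sym -lt0n m0 andbT /=; move: (d - a) m0 => m m0.
case: a ad => //= a _; rewrite {1}/geq /= m0 /=.
by elim: a => //= a ->.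
Qed.

Lemma sumn_hook d a : a < d -> sumn (hook d a) = d.
Proof. by move=> ad; rewrite /= sumn_nseq mul1n subnK // ltnW. Qed.

Lemma conj_hook d a : a < d -> conj_part (hook d a) = hook d (d - a.+1).
Proof.
move=> ad; rewrite /conj_part /hook /= subKn // -(subnSK ad) /=.
rewrite count_nseq mul1n; congr (_ :: _).
apply: (@eq_from_nth _ 0) => [|i]; rewrite size_map size_iota ?size_nseq //.
move=> lt; rewrite (nth_map 0) ?size_iota // nth_iota // nth_nseq lt add1n.
by rewrite count_nseq /= addn0 ltnS lt.
Qed.

Lemma reshape_index_nseq1 r i : i < r -> reshape_index (nseq r 1) i = i.
Proof.
rewrite /reshape_index; elim: r i => // r IH [|i] //= lt.
by rewrite subn1 /= IH.
Qed.

Lemma reshape_index_hook d a i : a < d -> i < d ->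
  reshape_index (hook d a) i = if i < d - a then 0 else (i - (d - a)).+1.
Proof.
move=> ad id; rewrite /reshape_index /hook /=.
rewrite subn_eq0; case: ifP => // /negbT; rewrite -leqNgt => le.
rewrite subSn //; congr _.+1; apply: reshape_index_nseq1.
by rewrite ltn_subLR // subnK // ltnW.
Qed.

Lemma young_hookP d a (s : 'S_d) : a < d ->
  (s \in young d (hook d a)) = perm_on [set i : 'I_d | i < d - a] s.
Proof.
move=> ad; rewrite inE; apply/forallP/idP => [sP|sP i].
  apply/subsetP => i; apply: contraR; rewrite inE => /negPf ia.
  apply/eqP/val_inj; have /eqP := sP i.
  rewrite !reshape_index_hook // ia; case: ifP => //= /negbT.
  rewrite -leqNgt => sia [E]; rewrite -(subnK sia) E subnK //.
  by rewrite leqNgt ia.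
rewrite !reshape_index_hook //; have := perm_closed i sP; rewrite !inE => ->.
case: ifP => // ia; rewrite (out_perm sP) ?inE ?ia //.
Qed.

End HookShape.


Section HookCharacters.
Import GroupScope GRing.Theory Num.Theory Order.TTheory.
Local Open Scope ring_scope.

Variable d : nat.
Local Notation G := [set: 'S_d].

(** Substituting [- 'X] for ['X] in [ext_char_poly] turns the signs into those of
an alternating sum. *)
Lemma ext_charE (s : 'S_d) j :
  (-1) ^+ j * ext_char j s
  = (\prod_(b <- cycle_lengths s) (1 - 'X^b) : {poly algC})`_j.
Proof.
rewrite /cycle_lengths big_map big_enum /=.
have := congr1 (fun p => p \Po (- 'X)) (ext_char_poly s).
rewrite rmorph_sum rmorph_prod /=.
under [RHS]eq_bigr => C _ do
  rewrite rmorphB rmorph1 rmorphXn rmorphN /= comp_polyX opprK.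
move=> <-; rewrite coef_sum /ext_char mulr_sumr big_mkcond /=.
apply: eq_bigr => A _; rewrite comp_polyZ rmorphXn /= comp_polyX coefZ.
rewrite -[- 'X]mulN1r exprMn -polyCN -polyC_exp coefCM coefXn eq_sym.
by case: eqP => [->|_]; rewrite ?mulr1 ?mulr0 // mulrC.
Qed.

(** Up to the sign [(-1) ^+ a], the trace on the exterior power of degree [a]
of the [d.-1]-dimensional reflection module. *)
Definition hook_cf a : 'CF(G) := \sum_(j < a.+1) (-1) ^+ j *: ext_cf d j.

Lemma hook_cfE a (s : 'S_d) : (a < d)%N ->
  hook_cf a s =
  \sum_(j < a.+1) (\prod_(b <- cycle_lengths s) (1 - 'X^b) : {poly algC})`_j.
Proof.
move=> ad; rewrite sum_cfunE; apply: eq_bigr => j _.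
by rewrite cfunE ext_cfE ?ext_charE // (leq_trans _ ad) // ltnW.
Qed.

(** The value at [-1] of the polynomial of [ext_char_poly] is zero, as every
cycle contributes a factor that vanishes there. *)
Lemma alternating_ext_cf : (0 < d)%N ->
  \sum_(j < d.+1) (-1) ^+ j *: ext_cf d j = 0.
Proof.
move=> d0; apply/cfunP => s; rewrite sum_cfunE cfunE.
under eq_bigr => j _ do rewrite cfunE ext_cfE -1?ltnS // /ext_char mulr_sumr.
transitivity ((\sum_(A : {set 'I_d}) ext_sign A s *: 'X^#|A|).[-1] : algC).
  rewrite horner_sum [RHS](partition_big
    (fun A : {set 'I_d} => inord #|A| : 'I_d.+1) xpredT) //=.
  have cd (A : {set 'I_d}) : (#|A| < d.+1)%N.
    by rewrite ltnS -[X in (_ <= X)%N](card_ord d) max_card.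
  apply: eq_bigr => j _; apply: eq_big => [A|A /eqP <-].
    by rewrite -val_eqE /= inordK.
  by rewrite hornerZ hornerXn mulrC.
rewrite ext_char_poly horner_prod.
rewrite (bigD1 (porbit s (Ordinal d0))) /=; last by apply: imset_f.
by rewrite !(hornerE, horner_exp) opprK expr1n subrr mul0r.
Qed.

(** Since the full alternating sum vanishes, [hook_cf a] is also minus the sum of
the terms of degree larger than [a]. So a constituent occurs in some degree at
most [a] and in some larger degree, and by [ext_cf_ortho] these degrees are
consecutive. *)
Lemma hook_cf_constt a i : (a < d)%N -> i \in irr_constt (hook_cf a) ->
  i \in irr_constt (ext_cf d a) /\ i \in irr_constt (ext_cf d a.+1).
Proof.
move=> ad ia; have d0 : (0 < d)%N by apply: leq_ltn_trans ad.
have ex (P : pred 'I_d.+1) :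
    '[\sum_(j < d.+1 | P j) (-1) ^+ j *: ext_cf d j, 'chi_i] != 0 ->
    exists2 j : 'I_d.+1, P j & i \in irr_constt (ext_cf d j).
  rewrite cfdot_suml => nz.
  have [j Pj jnz] : exists2 j, P j & '[(-1) ^+ nat_of_ord j *: ext_cf d j, 'chi_i] != 0.
    apply/exists_inP; apply: contraNT nz; rewrite negb_exists_in => /forall_inP h.
    by rewrite big1 // => j Pj; apply/eqP; have := h j Pj; rewrite negbK.
  exists j => //; rewrite irr_consttE; apply: contraNneq jnz => E.
  by rewrite cfdotZl E mulr0.
have lowE : hook_cf a = \sum_(j < d.+1 | (j <= a)%N) (-1) ^+ j *: ext_cf d j.
  by rewrite (big_ord_narrow_leq (ltnW ad)).
have [j ja ij] : exists2 j : 'I_d.+1, (j <= a)%N & i \in irr_constt (ext_cf d j).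
  by apply: ex; rewrite -lowE -irr_consttE.
have [j' ja' ij'] : exists2 j : 'I_d.+1, ~~ (j <= a)%N & i \in irr_constt (ext_cf d j).
  apply: ex; have := alternating_ext_cf d0.
  rewrite (bigID (fun j : 'I_d.+1 => (j <= a)%N)) /= -lowE => /eqP.
  rewrite addrC addr_eq0 => /eqP ->.
  by rewrite cfdotNl oppr_eq0 -irr_consttE.
rewrite -ltnNge in ja'.
have : ~~ (j.+1 < j' <= d)%N.
  apply/negP => /ext_cf_ortho E.
  have := not_ortho_common_constt (ext_cf_char d j) (ext_cf_char d j') ij ij'.
  by rewrite E eqxx.
rewrite -[(j' <= d)%N]ltnS ltn_ord andbT -leqNgt => le.
have Ej : (j = a :> nat)%N.
  by apply/eqP; rewrite eqn_leq ja -ltnS (leq_trans ja' le).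
have Ej' : (j' = a.+1 :> nat)%N.
  by apply/eqP; rewrite eqn_leq ja' andbT (leq_trans le) // Ej.
by split; [rewrite -Ej|rewrite -Ej'].
Qed.

(** Frobenius reciprocity: a constituent of the induced character restricts to the
stabiliser with [lin_ext A] as a constituent, hence to [H] with [xi] as one. *)
Lemma ext_constt_Ind A (H : {group 'S_d}) (xi : 'CF(H)) i :
  H \subset 'N(A | 'P) -> 'Res[H] (lin_ext A) = xi ->
  i \in irr_constt (ext_cf d #|A|) -> i \in irr_constt ('Ind[G] xi).
Proof.
move=> sHN <-; rewrite -Ind_lin_ext_cf.
have L := lin_ext_lin A; have /irrP[j Ej] := lin_char_irr L; rewrite Ej in L *.
have /irrP[k Ek] := lin_char_irr (cfRes_lin_char H L).
rewrite constt_Ind_Res Ek constt_Ind_Res => ji.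
rewrite -(cfResRes _ sHN (subsetT _)); apply: (constt_Res_trans _ ji).
  exact: cfRes_char (irr_char i).
by rewrite Ek constt_irr inE.
Qed.

Lemma card_ord_ge m : (m <= d)%N -> #|[set x : 'I_d | (m <= x)%N]| = (d - m)%N.
Proof.
move=> md; have <- : ~: [set x : 'I_d | (x < m)%N] = [set x : 'I_d | (m <= x)%N].
  by apply/setP => x; rewrite !inE -leqNgt.
by rewrite -[d in RHS]card_ord -(cardsC [set x : 'I_d | (x < m)%N]) card_ord_lt // addKn.
Qed.

Lemma perm_on_stab (A : {set 'I_d}) (s : 'S_d) : perm_on A s -> s \in 'N(A | 'P).
Proof. by move=> As; apply/setwise_stabP => x xA; rewrite perm_closed. Qed.

(** A constituent of [hook_cf a] occurs in the exterior powers of degrees [a] and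
[a.+1]. The first is a summand of the character induced from the trivial
character of the Young subgroup of the hook, the second of the one induced from
the sign of the conjugate Young subgroup, and [cfdot_young_hook] leaves room for
one common constituent only. Central characters are insensitive to the
scalar [m]. *)
Lemma hook_cf_irr a : (a < d)%N ->
  exists i : Iirr G, exists2 m : algC, m != 0 &
    irr_part d (hook d a) = 'chi_i /\ hook_cf a = m *: 'chi_i.
Proof.
move=> ad; have a1d : (d - a.+1 < d)%N by rewrite ltn_subrL (leq_ltn_trans _ ad).
pose A0 := [set x : 'I_d | (x < d - a)%N].
pose B0 := [set x : 'I_d | (x < d - (d - a.+1))%N].
have KP s : (s \in young d (hook d a)) = perm_on A0 s by apply: young_hookP.
have LP s : (s \in young d (conj_part (hook d a))) = perm_on B0 s.
  by rewrite conj_hook // young_hookP.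
have cardB : #|B0| = a.+1 by rewrite card_ord_lt subKn ?leq_subr.
have cardAB : (#|A0| + #|B0| = d.+1)%N.
  by rewrite cardB card_ord_lt ?leq_subr // addnS subnK // ltnW.
pose A1 := [set x : 'I_d | (d - a <= x)%N].
have cardA1 : #|A1| = a by rewrite card_ord_ge ?leq_subr // subKn // ltnW.
have A1C : A1 = ~: A0 by apply/setP => x; rewrite !inE -leqNgt.
have stabA1 : 'N(A1 | 'P) = 'N(A0 | 'P) by rewrite A1C astabsC.
set phi := 'Ind[G] (1 : 'CF(young d (hook d a))).
set psi := 'Ind[G] ('Res[young d (conj_part (hook d a))] (sgn d)).
have common i : i \in irr_constt (hook_cf a) ->
    i \in irr_constt phi /\ i \in irr_constt psi.
  case/(hook_cf_constt ad) => ia ia1; split.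
    apply: (@ext_constt_Ind A1); rewrite ?cardA1 //.
      by apply/subsetP => s; rewrite KP => /perm_on_stab; rewrite -stabA1.
    apply/cfun_inP => s sK; rewrite cfResE ?cfun1E ?sK.
    - rewrite lin_extE ext_sign_fix // => x; rewrite A1C inE => xA.
      by rewrite KP in sK; rewrite (out_perm sK).
    - by apply/subsetP => t; rewrite KP => /perm_on_stab; rewrite -stabA1.
    - by [].
  apply: (@ext_constt_Ind B0); rewrite ?cardB //.
    by apply/subsetP => s; rewrite LP => /perm_on_stab.
  apply/cfun_inP => s sL; rewrite !cfResE ?subsetT //; last first.
    by apply/subsetP => t; rewrite LP => /perm_on_stab.
  by rewrite lin_extE sgnE ext_sign_perm_on // -LP.
have phiC : phi \is a character by rewrite cfInd_char ?rpred1.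
have psiC : psi \is a character.
  by rewrite cfInd_char // cfRes_char // lin_charW // sgn_lin.
have le1 : '[phi, psi] <= 1 := cfdot_young_hook KP LP cardAB.
(* On a long cycle the generating polynomial is 1 - 'X^d, so only the term of
   degree zero contributes to the value. *)
have nz : hook_cf a != 0.
  have d0 : (0 < d)%N by apply: leq_ltn_trans ad.
  have dp : is_part [:: d] by rewrite /is_part /= inE eq_sym -lt0n d0.
  have := cycle_class_neq0 dp (addn0 d); set c := repr _ => cP.
  have lc : perm_eq (cycle_lengths c) [:: d].
    by move: cP; rewrite cycle_class_lengths // inE.
  apply: contraTneq (oner_neq0 algC) => E; rewrite negbK.
  have := hook_cfE c ad; rewrite E cfunE => ->.
  rewrite (perm_big _ lc) big_seq1 big_ord_recl big1 ?addr0; last first.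
    move=> i _; rewrite coefB coef1 coefXn /= /bump /=.
    by rewrite ltn_eqF ?subrr // add1n (leq_ltn_trans _ ad) // -ltnS.
  by rewrite coefB coef1 coefXn /= ltn_eqF // subr0.
have /neq0_has_constt[i0 i0a] := nz.
have [i0phi i0psi] := common _ i0a.
rewrite /irr_part -/phi -/psi.
case: pickP => [i /andP[iphi ipsi]|/(_ i0)]; last by rewrite i0phi i0psi.
have Ei : i0 = i by apply: (common_constt_uniq phiC psiC).
subst i0; exists i, '[hook_cf a, 'chi_i]; first by rewrite -irr_consttE.
split=> //; rewrite {1}[hook_cf a]cfun_sum_constt (big_pred1 i) // => j.
apply/idP/eqP => [ja|->//]; have [jphi jpsi] := common _ ja.
exact: (common_constt_uniq phiC psiC).
Qed.

End HookCharacters.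

(** * Generating polynomial of the hook characters, and convolution *)

Section HookPoly.
Import GRing.Theory.
Local Open Scope ring_scope.

Definition geom_poly (R : nzRingType) (b : nat) : {poly R} := \sum_(i < b) 'X^i.

(** The quotient of the product of the [1 - 'X^b], for [b] in [l], by [1 - 'X]. *)
Definition hook_poly (R : nzRingType) (l : seq nat) : {poly R} :=
  geom_poly R (head 0%N l) * \prod_(b <- behead l) (1 - 'X^b).

Variable R : comNzRingType.

Lemma geom_polyE b : (1 - 'X) * geom_poly R b = 1 - 'X^b.
Proof.
rewrite -[X in _ = X - _](expr1n _ b) subrXX; congr (_ * _).
by apply: eq_bigr => i _; rewrite expr1n mul1r.
Qed.

(** Dividing by [1 - 'X] amounts to taking partial sums of the coefficients; the
virtual characters [hook_cf a] are such partial sums. *)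
Lemma sum_coef_subX (p : {poly R}) a : \sum_(j < a.+1) ((1 - 'X) * p)`_j = p`_a.
Proof.
elim: a => [|a IH]; first by rewrite big_ord1 mulrBl mul1r coefB coefXM subr0.
by rewrite big_ord_recr /= IH mulrBl mul1r coefB coefXM /= addrC subrK.
Qed.

Lemma hook_polyE l : (0 < size l)%N ->
  \prod_(b <- l) (1 - 'X^b) = (1 - 'X) * hook_poly R l.
Proof.
by case: l => // b l _; rewrite big_cons /hook_poly /= mulrA geom_polyE.
Qed.

Lemma size_geom_poly b : (size (geom_poly R b) <= b)%N.
Proof.
apply: leq_trans (size_sum _ _ _) _; apply/bigmax_leqP => i _.
by rewrite size_polyXn.
Qed.

Lemma size_hook_poly l : (size (hook_poly R l) <= sumn l)%N.
Proof.
case: l => [|b l]; first by rewrite /hook_poly /geom_poly big_ord0 mul0r size_poly0.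
rewrite /hook_poly /=.
have le : (size (\prod_(b <- l) (1 - 'X^b) : {poly R})%R <= (sumn l).+1)%N.
  elim: l => [|c l IH]; first by rewrite big_nil size_poly1.
  rewrite big_cons /=; apply: leq_trans (size_polyMleq _ _) _.
  have lc : (size (1 - 'X^c : {poly R})%R <= c.+1)%N.
    by rewrite (leq_trans (size_polyD _ _)) //
      size_polyN size_polyXn size_poly1 geq_max leqnn andbT.
  by rewrite -subn1 leq_subLR add1n -addSn -addnS leq_add.
apply: leq_trans (size_polyMleq _ _) _.
by rewrite -subn1 leq_subLR add1n -addnS leq_add ?size_geom_poly.
Qed.

(** The sum of the coefficients is the value at 1, where a second factor
[1 - 'X^b] vanishes. *)
Lemma sum_hook_poly l :
  \sum_(a < sumn l) (hook_poly R l)`_a = (sumn l)%:R *+ (size l == 1%N).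
Proof.
transitivity (hook_poly R l).[1].
  rewrite (horner_coef_wide _ (size_hook_poly l)).
  by apply: eq_bigr => i _; rewrite expr1n mulr1.
rewrite /hook_poly /geom_poly hornerM horner_sum horner_prod.
under [X in X * _]eq_bigr => i _ do rewrite hornerXn expr1n.
rewrite sumr_const card_ord; case: l => [|b [|c l]] /=.
- by rewrite mul0r.
- by rewrite big_nil mulr1 addn0.
- by rewrite big_cons hornerD hornerN hornerXn hornerC expr1n subrr mul0r mulr0.
Qed.

End HookPoly.

Section FfunCons.

Variables (T : finType) (n : nat).

Definition ffun_cons (x : T) (w : {ffun 'I_n -> T}) : {ffun 'I_n.+1 -> T} :=
  [ffun i => oapp w x (unlift ord0 i)].

Lemma ffun_cons0 x w : ffun_cons x w ord0 = x.
Proof. by rewrite ffunE unlift_none. Qed.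

Lemma ffun_consS x w i : ffun_cons x w (lift ord0 i) = w i.
Proof. by rewrite ffunE liftK. Qed.

Lemma big_ffun_cons (R : Type) (idx : R) (op : Monoid.com_law idx)
    (F : {ffun 'I_n.+1 -> T} -> R) :
  \big[op/idx]_w F w = \big[op/idx]_x \big[op/idx]_w F (ffun_cons x w).
Proof.
rewrite pair_bigA /= (reindex (fun p => ffun_cons p.1 p.2)) //=.
exists (fun w => (w ord0, [ffun i => w (lift ord0 i)])) => [[x w] _|w _] /=.
  by rewrite ffun_cons0; congr (_, _); apply/ffunP => i; rewrite ffunE ffun_consS.
apply/ffunP => i; case: (unliftP ord0 i) => [j|] ->.
  by rewrite ffun_consS ffunE.
by rewrite ffun_cons0.
Qed.

End FfunCons.

Lemma big_ffun0 (T : finType) (R : Type) (idx : R) (op : Monoid.com_law idx)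
    (F : {ffun 'I_0 -> T} -> R) (w0 : {ffun 'I_0 -> T}) :
  \big[op/idx]_w F w = F w0.
Proof.
by rewrite (big_pred1 w0) // => w; apply/esym/eqP/ffunP => -[].
Qed.

Section Convolution.
Import GroupScope GRing.Theory Num.Theory.
Local Open Scope ring_scope.

Variables (gT : finGroupType).
Local Notation G := [set: gT].

Lemma class_fun_inv_subproof (theta : gT -> algC) :
  (forall x y, theta (x ^ y)%g = theta x) ->
  is_class_fun <<G>> [ffun x => theta x^-1%g].
Proof.
move=> thetaJ; rewrite genGid; apply: intro_class_fun => [x y _ _|x].
  by rewrite -conjVg thetaJ.
by rewrite inE.
Qed.

(** A class function acts on an irreducible module as a scalar. On characters this
is the generalised orthogonality relation, applied to the expansion of
[fun x => theta x^-1] over the irreducible characters. *)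
Lemma irr_convolution (theta : gT -> algC) (i : Iirr G) y :
  (forall x z, theta (x ^ z)%g = theta x) ->
  \sum_x theta x * 'chi_i (x * y)%g
  = (\sum_x theta x * 'chi_i x / 'chi_i 1%g) * 'chi_i y.
Proof.
move=> thetaJ; pose f : 'CF(G) := Cfun 0 (class_fun_inv_subproof thetaJ).
have fE x : theta x = \sum_j '[f, 'chi_j] * 'chi_j x^-1%g.
  have -> : theta x = f x^-1%g by rewrite cfunE invgK.
  by rewrite {1}[f]cfun_sum_cfdot sum_cfunE; apply: eq_bigr => j _; rewrite cfunE.
have E z : \sum_x theta x * 'chi_i (x * z)%g
    = #|G|%:R * '[f, 'chi_i] * ('chi_i z / 'chi_i 1%g).
  under eq_bigr => x _ do rewrite fE mulr_suml.
  rewrite exchange_big /= (bigD1 i) //= [X in _ + X]big1 ?addr0 => [|j neq].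
    have := generalized_orthogonality_relation z i i.
    rewrite eqxx mul1r => <-.
    rewrite mulrACA divff ?mul1r; last by rewrite pnatr_eq0 -lt0n cardG_gt0.
    rewrite mulr_sumr; apply: eq_big => [x|x _]; first by rewrite inE.
    by rewrite mulrAC mulrA.
  under eq_bigr => x _ do rewrite -mulrA [_ * 'chi_i _]mulrC.
  rewrite -mulr_sumr; have := generalized_orthogonality_relation z i j.
  rewrite eq_sym (negPf neq) mul0r => /eqP; rewrite mulf_eq0 invr_eq0.
  rewrite pnatr_eq0 -leqn0 leqNgt cardG_gt0 /= => /eqP E.
  by rewrite (eq_bigl (mem G)) ?E ?mulr0 // => x; rewrite /= in_setT.
rewrite E; have := E 1%g.
under eq_bigr => x _ do rewrite mulg1.
rewrite divff ?mulr1 ?irr1_neq0 // => E1.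
by rewrite -mulr_suml E1 mulrA mulrAC.
Qed.

Lemma cfun_mulC (phi : 'CF(G)) x y : phi (x * y)%g = phi (y * x)%g.
Proof. by rewrite -(cfunJ phi (x * y) (in_setT x)) conjgE !mulgA mulVg mul1g. Qed.

Lemma irr_convolution_prod n (theta : 'I_n -> gT -> algC) (i : Iirr G) y :
  (forall j x z, theta j (x ^ z)%g = theta j x) ->
  \sum_(w : {ffun 'I_n -> gT})
     (\prod_j theta j (w j)) * 'chi_i (y * \prod_j w j)%g
  = (\prod_j \sum_x theta j x * 'chi_i x / 'chi_i 1%g) * 'chi_i y.
Proof.
elim: n theta y => [|n IH] theta y thetaJ.
  by rewrite (big_ffun0 _ _ [ffun=> 1%g]) !big_ord0 mulg1.
rewrite big_ffun_cons big_ord_recl -mulrA -[X in _ * X](IH (fun j => theta (lift ord0 j))) //.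
rewrite mulr_sumr exchange_big /=; apply: eq_bigr => w _.
rewrite [X in _ * (_ * X)]cfun_mulC mulrCA -irr_convolution //.
rewrite mulr_sumr; apply: eq_bigr => x _; rewrite !big_ord_recl !ffun_cons0.
have -> : (\prod_(j < n) ffun_cons x w (lift ord0 j) = \prod_j w j)%g.
  by apply: eq_bigr => j _; rewrite ffun_consS.
rewrite (eq_bigr (fun j => theta (lift ord0 j) (w j))); last first.
  by move=> j _; rewrite ffun_consS.
rewrite -mulrA mulrCA; congr (_ * (_ * _)).
by rewrite cfun_mulC -mulgA.
Qed.

End Convolution.

(** * Completed cycles on hooks *)

Section PartLe.
Local Open Scope nat_scope.

Lemma mem_partitions_le d l :
  (l \in partitions_le d) = is_part l && (sumn l <= d).
Proof.
apply/flattenP/andP => [[s /mapP[m]]|[lp ld]].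
  rewrite mem_iota add0n ltnS => /andP[_ md] ->; rewrite mem_partitions.
  by case/andP => -> /eqP ->.
exists (partitions (sumn l)); last by rewrite mem_partitions lp eqxx.
by apply: map_f; rewrite mem_iota add0n ltnS.
Qed.

Lemma part_leP d (eta : part_le d) : is_part (val eta) /\ sumn (val eta) <= d.
Proof. by apply/andP; rewrite -mem_partitions_le; apply: valP. Qed.

Definition enum_part_le d : seq (seq nat) := map val (enum (part_le d)).

Lemma enum_part_le_uniq d : uniq (enum_part_le d).
Proof. by rewrite map_inj_uniq ?enum_uniq //; apply: val_inj. Qed.

Lemma mem_enum_part_le d l :
  (l \in enum_part_le d) = is_part l && (sumn l <= d).
Proof.
rewrite -mem_partitions_le; apply/mapP/idP => [[e _ ->]|lP]; first exact: valP.
by exists (SeqSub lP); rewrite // mem_enum.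
Qed.

Lemma sum_part_le_widen (V : nmodType) (F : seq nat -> V) D M : D <= M ->
  (forall l, is_part l -> D < sumn l -> F l = 0%R) ->
  (\sum_(e : part_le D) F (val e) = \sum_(e : part_le M) F (val e))%R.
Proof.
move=> DM F0.
have E m : (\sum_(e : part_le m) F (val e) = \sum_(l <- enum_part_le m) F l)%R.
  by rewrite big_map big_enum.
rewrite !E [RHS](bigID (fun l => sumn l <= D)) /= [X in (_ + X)%R]big1_seq ?GRing.addr0.
  rewrite -[RHS]big_filter; apply: perm_big; apply: uniq_perm.
  - exact: enum_part_le_uniq.
  - by rewrite filter_uniq ?enum_part_le_uniq.
  move=> l; rewrite mem_filter !mem_enum_part_le andbCA; congr (_ && _).
  by apply/idP/andP => [lD|[]//]; rewrite lD (leq_trans lD).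
move=> l; rewrite -ltnNge mem_enum_part_le => /and3P[lD lp _].
exact: F0.
Qed.

End PartLe.

Section HurwitzHook.
Import GroupScope GRing.Theory Num.Theory Order.TTheory.
Local Open Scope ring_scope.

Lemma perm_cycle_lengths d (s : 'S_d) mu :
  cycle_type s = mu -> perm_eq (cycle_lengths s) mu.
Proof. by move=> <-; rewrite perm_sym /cycle_type perm_sort. Qed.

Lemma cycle_typeE d (s : 'S_d) mu : sorted geq mu ->
  (cycle_type s == mu) = perm_eq (cycle_lengths s) mu.
Proof.
move=> mu_s; have := cycle_class_lengths d mu_s.
by move/setP/(_ s); rewrite !inE.
Qed.

Lemma cycle_typeV d (s : 'S_d) : cycle_type s^-1%g = cycle_type s.
Proof. by rewrite /cycle_type porbitsV. Qed.

Lemma cycle_lengths_nonempty d (s : 'S_d) : (0 < d)%N -> (0 < size (cycle_lengths s))%N.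
Proof.
move=> d0; rewrite size_map -cardE card_gt0; apply/set0Pn.
by exists (porbit s (Ordinal d0)); apply: imset_f.
Qed.

Lemma sumn_cycle_lengths d (s : 'S_d) : sumn (cycle_lengths s) = d.
Proof.
rewrite sumnE /cycle_lengths big_map big_enum /=.
rewrite (eqP (trivIset_porbits s)) -[RHS]card_ord -cardsT; congr #|pred_of_set _|.
apply/setP => x; rewrite inE; apply/bigcupP; exists (porbit s x).
  exact: imset_f.
exact: porbit_id.
Qed.

Lemma cycle_typeJ d (s t : 'S_d) : cycle_type (s ^ t)%g = cycle_type s.
Proof.
have pJ x : porbit (s ^ t)%g (t x) = t @: porbit s x.
  apply/setP => y; apply/porbitP/imsetP => [[i ->]|[_ /porbitP[i ->] ->]].
    by exists ((s ^+ i)%g x); rewrite ?mem_porbit // -conjXg permJ.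
  by exists i; rewrite -conjXg permJ.
apply/eqP; rewrite cycle_typeE; last first.
  by apply: sort_sorted => x y; rewrite /geq /= leq_total.
rewrite perm_sym /cycle_type perm_sort perm_sym; apply/seq.permP => p.
rewrite !count_cycle_lengths.
have -> : porbits (s ^ t)%g = (fun C : {set 'I_d} => t @: C) @: porbits s.
  apply/setP => C; apply/imsetP/imsetP => [[x _ ->]|[_ /imsetP[x _ ->] ->]].
    by rewrite -(permKV t x) pJ; exists (porbit s (t^-1%g x)); rewrite ?imset_f.
  by exists (t x); rewrite ?pJ.
rewrite big_imset /=; last by move=> C D _ _ /(imset_inj (@perm_inj _ t)).
by apply: eq_bigr => C _; rewrite card_imset //; apply: perm_inj.
Qed.


Lemma hook_cf_poly d a (s : 'S_d) l : (a < d)%N -> perm_eq (cycle_lengths s) l ->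
  hook_cf d a s = (hook_poly algC l)`_a.
Proof.
move=> ad sl; have l0 : (0 < size l)%N.
  by rewrite -(perm_size sl) cycle_lengths_nonempty // (leq_ltn_trans _ ad).
rewrite hook_cfE // (perm_big _ sl) /= hook_polyE //.
exact: sum_coef_subX.
Qed.

(** This replaces the column orthogonality of the character table for the class of
long cycles: it selects the long cycles by means of hooks only. *)
Lemma sum_hook_cf d (s : 'S_d) : (0 < d)%N ->
  \sum_(a < d) hook_cf d a s = d%:R * (cycle_type s == [:: d])%:R.
Proof.
move=> d0; under eq_bigr => a _ do rewrite (hook_cf_poly (ltn_ord a) (perm_refl _)).
have := sum_hook_poly algC (cycle_lengths s).
rewrite sumn_cycle_lengths => ->; rewrite cycle_typeE // mulr_natr.
congr (_ *+ nat_of_bool _); have := sumn_cycle_lengths s.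
case: (cycle_lengths s) => [|b [|c l]] /=; first by move=> E; rewrite -E in d0.
  by rewrite addn0 => ->; rewrite perm_refl.
by move=> _; apply/esym/negbTE/negP => /perm_size.
Qed.

Variables (kappa : nat -> seq nat -> rat) (hkappa : shifted_coefs kappa).

(** The weight of a permutation in the completed cycle of length [k], divided by
[k`!]. *)
Definition completed_cycle d k (s : 'S_d) : algC :=
  \sum_(eta : part_le d)
    ratr (kappa k (val eta) / (k`!)%:R
          * 'C(count_mem 1%N (up d (val eta)), count_mem 1%N (val eta))%:R)
    * (cycle_type s == up d (val eta))%:R.

(** The expansion of the shifted power sum does not depend on the bound on the
sizes of the partitions: beyond the degree the coefficients vanish, and beyond
the size of [l] the functions [f_shift] do. *)
Lemma p_shift_part_le k l : (0 < k)%N -> is_part l ->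
  ratr (p_shift k l)
  = \sum_(eta : part_le (sumn l)) ratr (kappa k (val eta)) * f_shift (val eta) l.
Proof.
move=> k0 lp; have [D [kD ->//]] := hkappa k0.
pose F eta := ratr (kappa k eta) * f_shift eta l.
rewrite (@sum_part_le_widen _ F D (maxn D (sumn l))) ?leq_maxl //; last first.
  by move=> eta ep lt; rewrite /F kD // raddf0 mul0r.
rewrite -(@sum_part_le_widen _ F (sumn l)) ?leq_maxr // => eta ep lt.
by rewrite /F /f_shift bin_small // !mul0r mulr0.
Qed.

(** The function [f_shift] is by definition the central character of a class, up to
the binomial coefficients compared in [card_cycle_class_up]; so the scalar by
which the completed cycle acts on a hook is the shifted power sum. *)
Lemma completed_cycle_hook d a k (i : Iirr [set: 'S_d]) :
  (0 < k)%N -> (a < d)%N -> irr_part d (hook d a) = 'chi_i ->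
  (forall s t : 'S_d, cycle_type s = cycle_type t -> 'chi_i s = 'chi_i t) ->
  \sum_s completed_cycle k s * 'chi_i s / 'chi_i 1%g
  = ratr (p_shift k (hook d a) / (k`!)%:R) :> algC.
Proof.
move=> k0 ad Ei chiC; rewrite fmorph_div /= p_shift_part_le ?hook_is_part //.
rewrite (sumn_hook ad) mulr_suml.
under eq_bigr => s _ do rewrite /completed_cycle !mulr_suml.
rewrite exchange_big /=; apply: eq_bigr => eta _.
have [ep ed] := part_leP eta; set e := val eta in ep ed *.
have rC := cycle_class_neq0 (up_is_part d ep) (sumn_up ed).
rewrite (bigID (fun s : 'S_d => s \in cycle_class d (up d e))) /=.
rewrite [X in _ + X]big1 ?addr0; last first.
  by move=> s; rewrite inE => /negPf ->; rewrite mulr0 !mul0r.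
rewrite (eq_bigr (fun=> ratr (kappa k e / (k`!)%:R
          * 'C(count_mem 1%N (up d e), count_mem 1%N e)%:R)
   * irr_part_val d (hook d a) (up d e) / 'chi_i 1%g)); last first.
  move=> s; rewrite inE => sC; rewrite sC mulr1 /irr_part_val Ei.
  congr (_ * _ / _); apply: chiC; move: rC; rewrite inE => /eqP ->.
  exact/eqP.
rewrite sumr_const /f_shift /irr_dim sumn_hook // Ei.
have := card_cycle_class_up ep ed; rewrite -/e.
move/(congr1 (fun n => n%:R : algC)); rewrite !natrM => E.
rewrite !rmorphM /= !ratr_nat fmorphV /= ratr_nat -[_ *+ _]mulr_natr.
rewrite -E; ring.
Qed.


Lemma completed_cycleJ d k (s t : 'S_d) :
  completed_cycle k (s ^ t)%g = completed_cycle k s.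
Proof. by apply: eq_bigr => eta _; rewrite cycle_typeJ. Qed.

Lemma hook_cf_convolution d a n (k : 'I_n -> nat) (y : 'S_d) : (a < d)%N ->
  (forall i, 0 < k i)%N ->
  \sum_(w : {ffun 'I_n -> 'S_d})
     (\prod_i completed_cycle (k i) (w i)) * hook_cf d a (y * \prod_i w i)%g
  = ratr (\prod_i (p_shift (k i) (hook d a) / ((k i)`!)%:R)) * hook_cf d a y.
Proof.
move=> ad k0; have [i [m m0 [Ei hE]]] := hook_cf_irr ad.
have hv u : hook_cf d a u = m * 'chi_i u by rewrite hE cfunE.
have chiC (s t : 'S_d) : cycle_type s = cycle_type t -> 'chi_i s = 'chi_i t.
  move=> st; apply: (mulfI m0).
  rewrite -!hv (hook_cf_poly ad (perm_cycle_lengths st)).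
  by rewrite (hook_cf_poly ad (perm_cycle_lengths (erefl _))).
rewrite rmorph_prod [in RHS]hv [RHS]mulrCA.
under [LHS]eq_bigr => w _ do rewrite hv mulrCA.
rewrite -mulr_sumr (@irr_convolution_prod _ n (fun j => completed_cycle (k j)));
  last by move=> j x z; apply: completed_cycleJ.
congr (_ * (_ * _)); apply: eq_bigr => j _.
exact: completed_cycle_hook.
Qed.

Lemma cycle_type_ones d (s : 'S_d) : cycle_type s = nseq d 1%N -> s = 1%g.
Proof.
move=> s1; have len1 (C : {set 'I_d}) : C \in porbits s -> #|C| = 1%N.
  move=> CP; have : #|C| \in cycle_type s.
    by rewrite /cycle_type mem_sort; apply/imageP; exists C.
  by rewrite s1 => /nseqP[].
apply/permP => x; rewrite perm1.
have pP : porbit s x \in porbits s by apply: imset_f.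
have /eqP/cards1P[y E] := len1 _ pP.
have := porbit_id s x; have := mem_porbit s 1 x.
by rewrite expg1 E => /set1P -> /set1P ->.
Qed.

Lemma cycle_type1 d : cycle_type (1%g : 'S_d) = nseq d 1%N.
Proof.
apply/eqP; rewrite cycle_typeE; last by case: d => //= d; elim: d.
have nE : cycle_lengths (1%g : 'S_d) = nseq (size (cycle_lengths (1%g : 'S_d))) 1%N.
  apply/all_pred1P/allP => _ /imageP[_ /imsetP[x _ ->] ->] /=.
  apply/eqP/eqP/cards1P; exists x; apply/eqP.
  rewrite eqEsubset sub1set porbit_id andbT; apply: sub_porbit (set11 x).
  by move=> y; rewrite perm1.
have := sumn_cycle_lengths (1%g : 'S_d); rewrite nE sumn_nseq mul1n => ->.
exact: perm_refl.
Qed.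

Lemma part_all_ones d nu : is_part nu -> sumn nu = d -> size nu = d ->
  nu = nseq d 1%N.
Proof.
case/andP => _ nu0 nud nus; rewrite -nus; apply/all_pred1P/allP => x xnu.
have {}nu0 : all (fun i => 0 < i)%N nu.
  by apply/allP => y ynu; rewrite lt0n; apply: contraNneq nu0 => <-.
have : sumn nu = size nu by rewrite nus nud.
elim: nu nu0 xnu {nud nus} => //= y nu IH /andP[y0 nu0].
have le : (size nu <= sumn nu)%N.
  elim: nu nu0 {IH} => //= z nu IH /andP[z0 nu0].
  by rewrite -add1n leq_add // IH.
move=> xin E; have [y1 sE] : y = 1%N /\ sumn nu = size nu.
  case: y y0 {xin} E => // -[|y] _ E; first by split=> //; case: E.
  exfalso; move: E; rewrite !addSn => -[E].
  by move: le; rewrite -E ltnNge leq_addl.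
by move: xin; rewrite inE => /orP[/eqP ->|/IH]; [rewrite y1|apply].
Qed.

End HurwitzHook.

(** * Hurwitz numbers with a long cycle as sums over hooks *)

Lemma map_hook_poly (R S : comNzRingType) (f : {rmorphism R -> S}) l :
  map_poly f (hook_poly R l) = hook_poly S l.
Proof.
rewrite /hook_poly /geom_poly rmorphM rmorph_sum rmorph_prod /=.
congr (_ * _); apply: eq_bigr => i _; first exact: map_polyXn.
by rewrite rmorphB rmorph1 /= map_polyXn.
Qed.

Section HurwitzSum.
Import GroupScope GRing.Theory Num.Theory Order.TTheory.
Local Open Scope ring_scope.

(** The third factor is the identity and the first is determined by the second
one; being an inverse, it has the same cycle type as [y * W]. *)
Lemma sum_long_triples d (b : seq nat) (W : 'S_d) :
  \sum_(v : {ffun 'I_3 -> 'S_d})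
     ((W * \prod_j v j == 1)%g
      && [forall j, cycle_type (v j)
            == tnth [tuple of rcons [tuple [:: d]; b] (nseq d 1%N)] j] : nat)
  = (\sum_(y : 'S_d | cycle_type y == b) (cycle_type (y * W)%g == [:: d]))%N.
Proof.
rewrite [RHS]big_mkcond /=.
pose h y : {ffun 'I_3 -> 'S_d} := [ffun j : 'I_3 => nth 1%g [:: (y * W)^-1; y; 1]%g j].
pose P (v : {ffun 'I_3 -> 'S_d}) := (W * \prod_j v j == 1)%g
      && [forall j, cycle_type (v j)
            == tnth [tuple of rcons [tuple [:: d]; b] (nseq d 1%N)] j].
pose j0 : 'I_3 := ord0; pose j1 : 'I_3 := lift ord0 ord0.
pose j2 : 'I_3 := lift ord0 (lift ord0 ord0).
have prodE (v : {ffun 'I_3 -> 'S_d}) :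
    (\prod_j v j = v j0 * (v j1 * v j2))%g.
  by rewrite !big_ord_recl big_ord0 mulg1.
have allE (v : {ffun 'I_3 -> 'S_d}) :
    [forall j, cycle_type (v j)
       == tnth [tuple of rcons [tuple [:: d]; b] (nseq d 1%N)] j]
    = [&& cycle_type (v j0) == [:: d], cycle_type (v j1) == b
        & cycle_type (v j2) == nseq d 1%N].
  apply/forallP/and3P => [H|[H0 H1 H2] j].
    by split; [have := H j0|have := H j1|have := H j2]; rewrite (tnth_nth [::]).
  rewrite (tnth_nth [::]).
  case: (unliftP ord0 j) => [j'|] -> //; case: (unliftP ord0 j') => [j''|] -> //.
  by case: (unliftP ord0 j'') => [j3|] -> //; case: j3.
transitivity (\sum_(v | P v) 1)%N.
  by rewrite [RHS]big_mkcond; apply: eq_bigr => v _; rewrite /P; case: ifP.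
transitivity (\sum_(y : 'S_d | (cycle_type y == b) && (cycle_type (y * W)%g == [:: d])) 1)%N.
  rewrite (reindex_onto h (fun v => v j1)) /=; last first.
    move=> v /andP[]; rewrite prodE allE => /eqP E /and3P[_ _ /eqP/cycle_type_ones v2].
    apply/ffunP => j; rewrite ffunE.
    case: (unliftP ord0 j) => [j'|] ->; last first.
      rewrite v2 mulg1 in E; apply: (mulgI W); apply: (mulIg (v j1)).
      by rewrite /= -[RHS]mulgA E invMg mulgA mulgV mul1g mulVg.
    case: (unliftP ord0 j') => [j''|] -> //.
    by case: (unliftP ord0 j'') => [j3|] -> //; case: j3.
  apply: eq_bigl => y; rewrite /P prodE allE !ffunE /= eqxx andbT mulg1.
  rewrite cycle_typeV cycle_type1 eqxx andbT [_ && (_ == b)]andbC.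
  by rewrite invMg mulgKV mulgV eqxx.
by rewrite big_mkcond [RHS]big_mkcond; apply: eq_bigr => y _; do 2!case: eqP.
Qed.

Lemma hurwitz_count_long d s (eta : 'I_s -> seq nat) (b : seq nat) :
  hurwitz_count d eta (tnth [tuple of rcons [tuple [:: d]; b] (nseq d 1%N)])
  = (\sum_(w : {ffun 'I_s -> 'S_d}) [forall i, cycle_type (w i) == up d (eta i)]
     * \sum_(y : 'S_d | cycle_type y == b)
         (cycle_type (y * \prod_i w i)%g == [:: d]))%N.
Proof.
under eq_bigr => w _ do rewrite -sum_long_triples big_distrr /=.
rewrite pair_bigA /= /hurwitz_count -sum1_card big_mkcond /=.
by apply: eq_bigr => -[w v] _; rewrite inE /=; case: eqP; do 2!case: forallP.
Qed.

Variables (kappa : nat -> seq nat -> rat) (hkappa : shifted_coefs kappa).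

Lemma hurwitz_m_ones d s (k : s.-tuple nat) (b : seq nat) :
  hurwitz_m kappa d d k [tuple [:: d]; b]
  = hurwitz kappa d k [tuple of rcons [tuple [:: d]; b] (nseq d 1%N)].
Proof.
rewrite /hurwitz_m big_seq_cond.
rewrite (eq_bigl (fun nu => nu == nseq d 1%N)) => [|nu].
  rewrite big_mkcond (bigD1_seq (nseq d 1%N)) ?partitions_uniq //=.
    by rewrite eqxx big1 ?addr0 // => nu /negPf ->.
  rewrite mem_partitions sumn_nseq mul1n eqxx andbT.
  by rewrite /is_part mem_nseq /= andbF andbT; case: (d) => //= n; elim: n.
rewrite mem_partitions; apply/andP/eqP => [[/andP[np /eqP nd] /eqP ns]|->].
  exact: part_all_ones.
rewrite size_nseq sumn_nseq mul1n !eqxx andbT; split=> //.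
rewrite /is_part mem_nseq /= andbF andbT; by case: (d) => //= n; elim: n.
Qed.

(** Select the long cycle by [sum_hook_cf], sum over the other factors by
[hook_cf_convolution], and count the class of [b]: its size cancels the order of
the centraliser. *)
Lemma hurwitz_hook d s (k : s.-tuple nat) (b : seq nat) : (0 < d)%N ->
  (forall i, 0 < tnth k i)%N -> is_part b -> sumn b = d ->
  ratr ((centraliser_order b)%:R * (hurwitz_m kappa d d k [tuple [:: d]; b] * d%:R))
  = ratr (\sum_(a < d) (hook_poly rat b)`_a
           * \prod_(i < s) (p_shift (tnth k i) (hook d a) / ((tnth k i)`!)%:R)) :> algC.
Proof.
move=> d0 k0 bp bd.
have H : ratr (hurwitz kappa d k [tuple of rcons [tuple [:: d]; b] (nseq d 1%N)])
  = (d`!)%:R^-1 * \sum_(y : 'S_d | cycle_type y == b)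
     \sum_(w : {ffun 'I_s -> 'S_d})
      (\prod_i completed_cycle kappa (tnth k i) (w i))
        * (cycle_type (y * \prod_i w i)%g == [:: d])%:R :> algC.
  rewrite /hurwitz rmorphM fmorphV rmorph_nat; congr (_ * _).
  rewrite rmorph_sum /= exchange_big /=.
  under [LHS]eq_bigr => eta _.
    rewrite rmorphM rmorph_nat hurwitz_count_long natr_sum mulr_sumr rmorph_prod /=.
    over.
  rewrite exchange_big /=; apply: eq_bigr => w _.
  rewrite -mulr_sumr.
  under eq_bigr => eta _ do rewrite natrM natr_sum mulrA.
  rewrite -mulr_suml; congr (_ * _).
  rewrite /completed_cycle bigA_distr_bigA /=; apply: eq_bigr => eta _.
  rewrite [RHS]big_split /=; congr (_ * _).
  case: (boolP [forall i, _]) => [/forallP al|/forallPn[i /negPf ni]].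
    by rewrite big1 // => i _; rewrite al.
  by rewrite (bigD1 i) //= ni mul0r.
rewrite rmorphM rmorphM !rmorph_nat hurwitz_m_ones /= H.
have d1 : d%:R != 0 :> algC by rewrite pnatr_eq0 -lt0n.
have E y : cycle_type y == b ->
    \sum_(w : {ffun 'I_s -> 'S_d})
      (\prod_i completed_cycle kappa (tnth k i) (w i))
        * (cycle_type (y * \prod_i w i)%g == [:: d])%:R
    = d%:R^-1 * \sum_(a < d) ratr ((hook_poly rat b)`_a
           * \prod_(i < s) (p_shift (tnth k i) (hook d a) / ((tnth k i)`!)%:R)) :> algC.
  move=> yb.
  under eq_bigr => w _ do rewrite -[_%:R](mulKf d1) -sum_hook_cf // mulrCA mulr_sumr.
  rewrite -mulr_sumr exchange_big /=; congr (_ * _); apply: eq_bigr => a _.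
  rewrite (hook_cf_convolution hkappa) // rmorphM /= mulrC; congr (_ * _).
  rewrite (hook_cf_poly (ltn_ord a) (perm_cycle_lengths (eqP yb))).
  by rewrite -(map_hook_poly (ratr : {rmorphism rat -> algC})) coef_map.
rewrite (eq_bigr _ E) sumr_const.
have cE : #|[pred y : 'S_d | cycle_type y == b]|%:R * (centraliser_order b)%:R
    = d`!%:R :> algC.
  rewrite -natrM -(card_cycle_class bp bd); congr ((_ * _)%N%:R).
  by apply: eq_card => y; rewrite !inE.
rewrite -[_ *+ _]mulr_natl rmorph_sum /=.
set S := \sum_(a < d) _.
transitivity ((d`!%:R)^-1
  * (#|[pred y : 'S_d | cycle_type y == b]|%:R * (centraliser_order b)%:R)
  * (d%:R^-1 * d%:R) * S : algC).
  ring.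
by rewrite cE mulVf ?mul1r ?mulVf ?mul1r // pnatr_eq0 -lt0n fact_gt0.
Qed.

End HurwitzSum.

(** * Differential operators and the series of sinh *)

Section EvenDerivatives.

Variable R : comNzRingType.
Implicit Types p q r : {poly R}.

(** The differential operator [q (D ^+ 2)] applied to [p]. *)
Definition even_diffop q p : {poly R} := \sum_(i < size q) q`_i *: p^`(i.*2).

Lemma derivn_large p n : (size p <= n)%N -> p^`(n) = 0.
Proof.
move=> le; apply/polyP => i; rewrite coef_derivn coef0 nth_default ?mul0rn //.
exact: leq_trans le (leq_addr _ _).
Qed.

Lemma derivn_derivn p m n : p^`(m)^`(n) = p^`(n + m).
Proof. by elim: n => [|n IH] //; rewrite addSn !derivnS IH. Qed.

(** A sufficiently high derivative of a polynomial vanishes, so the number of terms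
is immaterial. *)
Lemma even_diffop_widen q p M : (size q <= M)%N \/ (size p <= M)%N ->
  even_diffop q p = \sum_(i < M) q`_i *: p^`(i.*2).
Proof.
pose F i := q`_i *: p^`(i.*2) : {poly R}.
have F0 i : (size q <= i)%N \/ (size p <= i)%N -> F i = 0.
  case=> le; rewrite /F; first by rewrite nth_default ?scale0r.
  by rewrite derivn_large ?scaler0 // (leq_trans le) // -addnn leq_addr.
have E m n : (m <= n)%N -> (forall i, (m <= i)%N -> F i = 0) ->
    \sum_(i < m) F i = \sum_(i < n) F i.
  move=> mn Fm; rewrite (big_ord_widen _ F mn) [RHS](bigID (fun i : 'I_n => (i < m)%N)) /=.
  by rewrite [X in _ + X]big1 ?addr0 // => i; rewrite -leqNgt => /Fm.
move=> H; rewrite /even_diffop -/(F _).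
case: (leqP (size q) M) => le; first by apply: (E _ _ le) => i qi; apply: F0; left.
apply/esym/(E _ _ (ltnW le)) => i Mi; apply: F0.
by case: H => H; [left|right]; apply: leq_trans H Mi.
Qed.

Lemma even_diffop_cons q c p : even_diffop (q * 'X + c%:P) p = even_diffop q p^`(2) + c *: p.
Proof.
rewrite (@even_diffop_widen _ _ (size q).+1); last first.
  by left; rewrite (leq_trans (size_polyD _ _)) // geq_max
    (leq_trans (size_polyMleq _ _)) ?size_polyX ?addn2 // (leq_trans (size_polyC_leq1 _)).
rewrite big_ord_recl /= addrC; congr (_ + _); last first.
  by rewrite coefD coefMX coefC /= add0r.
apply: eq_bigr => i _.
rewrite coefD coefMX coefC /= addr0 add0n.
by rewrite -[(_^`())^`()]/(p^`(i.*2)^`(2)) -[p^`()^`()]/(p^`(2)) !derivn_derivn addnC.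
Qed.

Lemma even_diffop_derivn q p n : even_diffop q p^`(n) = (even_diffop q p)^`(n).
Proof.
rewrite /even_diffop linear_sum; apply: eq_bigr => i _ /=.
by rewrite derivnZ !derivn_derivn addnC.
Qed.


Lemma even_diffop_mul q r p : even_diffop (q * r) p = even_diffop q (even_diffop r p).
Proof.
elim/poly_ind: q p => [|q c IH] p.
  by rewrite mul0r /even_diffop size_poly0 !big_ord0.
rewrite even_diffop_cons -even_diffop_derivn -IH mulrDl mulrAC mul_polyC.
transitivity (even_diffop (q * r * 'X) p + even_diffop (c *: r) p).
  set M := maxn (size (q * r * 'X)) (size (c *: r)).
  rewrite !(@even_diffop_widen _ _ M) -?big_split /=;
    try by left; rewrite ?leq_maxl ?leq_maxr // size_polyD.
  by apply: eq_bigr => i _; rewrite coefD scalerDl.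
congr (_ + _).
  by have := even_diffop_cons (q * r) 0 p; rewrite polyC0 addr0 scale0r addr0.
rewrite (@even_diffop_widen (c *: r) p (size r)); last by left; rewrite size_scale_leq.
by rewrite /even_diffop scaler_sumr; apply: eq_bigr => i _; rewrite coefZ scalerA.
Qed.

End EvenDerivatives.

Lemma big_ord_double (V : nmodType) (F : nat -> V) n :
  \sum_(i < n.*2) F i = \sum_(i < n) (F i.*2 + F i.*2.+1).
Proof.
elim: n => [|n IH]; first by rewrite !big_ord0.
by rewrite doubleS !big_ord_recr /= IH addrA.
Qed.

Section SinhSeries.

Definition sinhc_coef (i : nat) : rat := (4 ^+ i * (i.*2.+1)`!%:R)^-1.

Lemma sinhc_coef_gt0 i : 0 < sinhc_coef i.
Proof. by rewrite invr_gt0 mulr_gt0 ?exprn_gt0 // ltr0n fact_gt0. Qed.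

Lemma sinhc_coef0 : sinhc_coef 0 = 1.
Proof. by rewrite /sinhc_coef expr0 mul1r invr1. Qed.

(** The truncated series of [sinh (b t / 2) / (b t / 2)], in the variable
[t ^+ 2]. The map [f] embeds the rational coefficients into [R]. *)
Definition sinhc (R : comNzRingType) (f : rat -> R) N (b : R) : {poly R} :=
  \poly_(i < N) (f (sinhc_coef i) * b ^+ i.*2).

Lemma map_sinhc (R S : comNzRingType) (h : {rmorphism R -> S}) f N b :
  map_poly h (sinhc f N b) = sinhc (h \o f) N (h b).
Proof.
apply/polyP => i; rewrite coef_map !coef_poly /=.
by case: ifP => _; rewrite ?rmorph0 // rmorphM rmorphXn.
Qed.

Lemma size_sinhc (R : comNzRingType) (f : rat -> R) N b : (size (sinhc f N b) <= N)%N.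
Proof. exact: size_poly. Qed.

(** Taylor expansion at [x]: the even derivatives cancel. *)
Lemma horner_central_diff N (p : {poly rat}) (b x : rat) : (size p <= N)%N ->
  p.[x + b / 2] - p.[x - b / 2] = b * (even_diffop (sinhc id N b) p^`()).[x].
Proof.
move=> pN; have pN2 : (size p <= N.*2)%N by rewrite (leq_trans pN) // -addnn leq_addr.
rewrite !(nderiv_taylor_wide (n := N.*2)) //; try exact: mulrC.
rewrite -sumrB (big_ord_double (fun i => p^`N(i).[x] * (b / 2) ^+ i
   - p^`N(i).[x] * (- (b / 2)) ^+ i)).
rewrite (@even_diffop_widen _ _ _ N); last by left; apply: size_sinhc.
rewrite horner_sum mulr_sumr; apply: eq_bigr => i _.
rewrite coef_poly ltn_ord hornerZ -derivSn nderivn_def hornerMn.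
set y := (p^`N(_)).[x]; set z := (p^`N(_)).[x]; set h := b / 2.
have -> : (- h) ^+ i.*2 = h ^+ i.*2.
  by rewrite exprNn -signr_odd odd_double mul1r.
have -> : (- h) ^+ i.*2.+1 = - h ^+ i.*2.+1.
  by rewrite exprNn -signr_odd /= odd_double mulN1r.
have -> : b = 2 * h by rewrite /h; field.
have -> : (2 * h) ^+ i.*2 = 4 ^+ i * h ^+ i.*2.
  by rewrite -mul2n !exprM -exprMn; congr (_ ^+ _); ring.
rewrite /sinhc_coef exprS -mulr_natr.
have F0 : (i.*2.+1`!)%:R != 0 :> rat by rewrite pnatr_eq0 -lt0n fact_gt0.
have P0 : 4 ^+ i != 0 :> rat by rewrite expf_neq0.
by field; rewrite F0 P0.
Qed.

End SinhSeries.

Section Parity.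

(** Reduction modulo 2 of the rationals with odd denominator, as a relation. *)
Definition mod2_value (x : rat) (e : 'F_2) : Prop :=
  exists a b : int, [/\ b%:~R = 1 :> 'F_2, a%:~R = e & x * b%:~R = a%:~R].

Lemma mod2_value_nat n : mod2_value n%:R n%:R.
Proof. by exists n%:Z, 1; rewrite mulr1 -!pmulrn. Qed.

Lemma mod2_valueD x y e f : mod2_value x e -> mod2_value y f -> mod2_value (x + y) (e + f).
Proof.
move=> [a [b [b1 <- xE]]] [c [d [d1 <- yE]]]; exists (a * d + c * b), (b * d).
rewrite !(rmorphM, rmorphD) /= b1 d1 !mulr1; split=> //.
by rewrite mulrDl mulrA xE [b%:~R * _]mulrC mulrA yE.
Qed.

Lemma mod2_valueM x y e f : mod2_value x e -> mod2_value y f -> mod2_value (x * y) (e * f).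
Proof.
move=> [a [b [b1 <- xE]]] [c [d [d1 <- yE]]]; exists (a * c), (b * d).
by rewrite !rmorphM /= b1 d1 mulr1; split=> //; rewrite mulrACA xE yE.
Qed.

Lemma mod2_valueV x : mod2_value x 1 -> mod2_value x^-1 1.
Proof.
move=> [a [b [b1 a1 xE]]]; exists b, a; split=> //.
have b0 : b%:~R != 0 :> rat.
  by rewrite intr_eq0; apply/eqP => E; move/eqP: b1; rewrite E mulr0z eq_sym oner_eq0.
rewrite -xE mulKf //; apply/eqP => x0; move/eqP: xE.
by rewrite x0 mul0r eq_sym intr_eq0 => /eqP E; move/eqP: a1; rewrite E mulr0z eq_sym oner_eq0.
Qed.

Lemma mod2_value_neq0 x : mod2_value x 1 -> x != 0.
Proof.
move=> [a [b [b1 a1 xE]]]; apply/eqP => x0; move/eqP: xE.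
by rewrite x0 mul0r eq_sym intr_eq0 => /eqP E; move/eqP: a1; rewrite E mulr0z eq_sym oner_eq0.
Qed.

Lemma mod2_value_sum n (F : nat -> rat) (e : nat -> 'F_2) :
  (forall i, (i < n)%N -> mod2_value (F i) (e i)) ->
  mod2_value (\sum_(i < n) F i) (\sum_(i < n) e i).
Proof.
elim: n => [|n IH] H; first by rewrite !big_ord0; apply: (mod2_value_nat 0).
rewrite !big_ord_recr /=; apply: mod2_valueD; last exact: H.
by apply: IH => i lt; apply: H; rewrite ltnW.
Qed.

(** By Pascal's rule, binomial coefficients with odd lower index in an odd row are
sums of two consecutive entries of the row above. *)
Lemma sum_odd_bin l : (\sum_(i < l.+1) 'C(l.*2.+1, i.*2.+1) = 2 ^ l.*2)%N.
Proof.
transitivity (\sum_(i < l.+1) ('C(l.*2, i.*2) + 'C(l.*2, i.*2.+1)))%N.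
  by apply: eq_bigr => i _; rewrite binS addnC.
rewrite -(big_ord_double (fun i => 'C(l.*2, i)) l.+1) doubleS big_ord_recr /=.
rewrite bin_small // addr0 -[RHS]/((1 + 1) ^ l.*2)%N Pascal.
by apply: eq_bigr => i _; rewrite !exp1n !muln1.
Qed.

(** Multiplied by [4 ^+ j * (j.*2)`!], the coefficients of the inverse series
satisfy a recursion with binomial coefficients, whose leading one is odd. The
other binomial coefficients of the row add up to an odd number by [sum_odd_bin],
so by induction all values are quotients of odd integers. *)
Lemma inv_sinhc_mod2 N : exists r : nat -> rat,
  [/\ r 0%N = 1, forall j, (j < N)%N -> mod2_value (r j) 1
    & forall l, (0 < l < N)%N ->
        \sum_(i < l.+1) 'C(l.*2.+1, i.*2.+1)%:R * r (l - i)%N = 0].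
Proof.
elim: N => [|N [r [r0 rodd rrec]]].
  by exists (fun=> 1); split=> // l; rewrite ltn0 andbF.
have [->|N0] := posnP N.
  exists (fun=> 1); split=> // [j _|l]; first exact: (mod2_value_nat 1).
  by rewrite ltnS => /andP[]; case: l.
pose T := \sum_(i < N) 'C(N.*2.+1, i.+1.*2.+1)%:R * r (N - i.+1)%N.
pose r' j := if j == N then - T / N.*2.+1%:R else r j.
have odd1 n : odd n -> n%:R = 1 :> 'F_2.
  move=> n_odd; rewrite -[n]odd_double_half n_odd -muln2 natrD natrM.
  by rewrite (_ : 2%:R = 0 :> 'F_2) ?mulr0 ?addr0 //; apply/val_inj.
have Todd : mod2_value T 1.
  have -> : 1 = \sum_(i < N) ('C(N.*2.+1, i.+1.*2.+1)%:R * 1) :> 'F_2.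
    under eq_bigr => i _ do rewrite mulr1.
    rewrite -natr_sum odd1 //.
    have := sum_odd_bin N; rewrite big_ord_recl /= bin1 => /(congr1 odd).
    rewrite oddD oddX /= odd_double /= orbF double_eq0.
    by rewrite (negPf (lt0n_neq0 N0)) => /negbFE.
  apply: (@mod2_value_sum N (fun i => 'C(N.*2.+1, i.+1.*2.+1)%:R * r (N - i.+1)%N)
    (fun i => 'C(N.*2.+1, i.+1.*2.+1)%:R * 1)) => i iN.
  by apply: mod2_valueM (mod2_value_nat _) (rodd _ _); rewrite subnSK // leq_subr.
exists r'; split=> [|j|l].
- by rewrite /r' eq_sym (negPf (lt0n_neq0 N0)).
- rewrite ltnS leq_eqVlt /r'; case: eqP => [_ _|_ /= /rodd //].
  have -> : 1 = (-1) * 1 * 1 :> 'F_2 by apply/val_inj.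
  rewrite -[- T]mulN1r; apply: (@mod2_valueM _ _ (-1 * 1) 1).
    apply: mod2_valueM => //; exists (-1), 1.
    by rewrite rmorphN1 mulr1.
  by apply: mod2_valueV; rewrite -(odd1 N.*2.+1) /= ?odd_double //; apply: mod2_value_nat.
rewrite ltnS => /andP[l0]; rewrite leq_eqVlt => /orP[/eqP ->|lN].
  rewrite big_ord_recl bin1 subn0 /r' eqxx mulrCA divff ?mulr1; last first.
    by rewrite pnatr_eq0.
  apply/eqP; rewrite addrC subr_eq0; apply/eqP; apply: eq_bigr => i _.
  by rewrite !lift0 ltn_eqF // ltn_subrL N0.
rewrite -[RHS](rrec l) ?l0 //; apply: eq_bigr => i _.
by rewrite /r' ltn_eqF // (leq_ltn_trans _ lN) // leq_subr.
Qed.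

(** No coefficient of the inverse of the series [sinhc] vanishes: multiplied by a
power of two and a factorial it is a quotient of two odd integers. This is what makes the
component of lowest degree of the final polynomial nonzero. *)
Lemma inv_sinhc N : exists s : nat -> rat,
  [/\ s 0%N = 1, forall j, (j < N)%N -> s j != 0
    & forall l, (0 < l < N)%N ->
        \sum_(i < l.+1) sinhc_coef i * s (l - i)%N = 0].
Proof.
have [r [r0 rodd rrec]] := inv_sinhc_mod2 N.
have F0 n : (n`!)%:R != 0 :> rat by rewrite pnatr_eq0 -lt0n fact_gt0.
have P0 n : 4 ^+ n != 0 :> rat by rewrite expf_neq0.
exists (fun j => r j / (4 ^+ j * (j.*2`!)%:R)); split=> [|j jN|l lN].
- by rewrite r0 expr0 mul1r double0 fact0 divr1.
- by rewrite mulf_neq0 ?invr_neq0 ?mulf_neq0 //; apply: mod2_value_neq0 (rodd _ jN).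
transitivity ((4 ^+ l * (l.*2.+1`!)%:R)^-1
  * \sum_(i < l.+1) 'C(l.*2.+1, i.*2.+1)%:R * r (l - i)%N); last first.
  by rewrite rrec // mulr0.
rewrite mulr_sumr.
apply: eq_bigr => -[i /= il] _; rewrite ltnS in il.
have := bin_fact (_ : i.*2.+1 <= l.*2.+1)%N; rewrite ltnS leq_double => /(_ il).
rewrite subSS -doubleB => E.
have -> : (l.*2.+1`!)%:R = 'C(l.*2.+1, i.*2.+1)%:R
    * ((i.*2.+1`!)%:R * ((l - i).*2`!)%:R) :> rat by rewrite -!natrM E.
have -> : 4 ^+ l = 4 ^+ (l - i) * 4 ^+ i :> rat by rewrite -exprD subnK.
rewrite /sinhc_coef.
have B0 : ('C(l.*2.+1, i.*2.+1))%:R != 0 :> rat.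
  by rewrite pnatr_eq0 -lt0n bin_gt0 ltnS leq_double.
by field; rewrite !F0 !P0 B0.
Qed.

End Parity.

(** * Summation over the hooks of a given size *)

Section HookSum.

Implicit Types (p q r f g : {poly rat}) (l : seq nat).

Lemma size_derivn_le p n : (size p^`(n) <= size p)%N.
Proof.
apply/leq_sizeP => j lej.
by rewrite coef_derivn nth_default ?mul0rn // (leq_trans lej) // leq_addl.
Qed.

Lemma size_even_diffop q p : (size (even_diffop q p) <= size p)%N.
Proof.
apply: leq_trans (size_sum _ _ _) _; apply/bigmax_leqP => i _.
exact: leq_trans (size_scale_leq _ _) (size_derivn_le _ _).
Qed.

Definition weighted_sum q p (x : rat) : rat :=
  \sum_(j < size q) q`_j * p.[x + j%:R].

Lemma weighted_sum_widen q p x M : (size q <= M)%N ->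
  weighted_sum q p x = \sum_(j < M) q`_j * p.[x + j%:R].
Proof.
move=> le; rewrite /weighted_sum.
rewrite (big_ord_widen _ (fun j => q`_j * p.[x + j%:R]) le) big_mkcond /=.
by apply: eq_bigr => j _; case: ltnP => // qj; rewrite nth_default // mul0r.
Qed.

Lemma weighted_sumB q r p x :
  weighted_sum (q - r) p x = weighted_sum q p x - weighted_sum r p x.
Proof.
pose M := maxn (size (q - r)) (maxn (size q) (size r)).
rewrite !(@weighted_sum_widen _ _ _ M) ?leq_max ?leqnn ?orbT // -sumrB.
by apply: eq_bigr => j _; rewrite coefB mulrBl.
Qed.

Lemma weighted_sumMX q p x :
  weighted_sum (q * 'X) p x = weighted_sum q p (x + 1).
Proof.
rewrite (@weighted_sum_widen _ _ _ (size q).+1); last first.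
  by rewrite (leq_trans (size_polyMleq _ _)) // size_polyX addn2.
rewrite big_ord_recl coefMX mul0r add0r; apply: eq_bigr => j _.
by rewrite coefMX !lift0 /= -addrA -natr1 [1 + _]addrC.
Qed.

Lemma weighted_sumMXn q p x b :
  weighted_sum (q * 'X^b) p x = weighted_sum q p (x + b%:R).
Proof.
elim: b x => [|b IH] x; first by rewrite mulr1 addr0.
by rewrite exprSr mulrA weighted_sumMX IH -addrA -[b.+1%:R]nat1r.
Qed.

(** Multiplying the weights by [1 - 'X^b] takes a central difference of step [b],
provided that the starting point is moved by [b / 2]; and a central difference
is the operator [b * sinhc b (D ^+ 2) * D]. *)
Lemma weighted_sum_diffs l p x N : (size p <= N)%N ->
  weighted_sum (\prod_(b <- l) (1 - 'X^b)) p (x - (sumn l)%:R / 2)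
  = (-1) ^+ size l * (\prod_(b <- l) b)%:R
    * (even_diffop (\prod_(b <- l) sinhc id N b%:R) p^`(size l)).[x].
Proof.
move=> pN; elim: l x => [|b l IH] x.
  rewrite !big_nil /weighted_sum /even_diffop size_poly1 !big_ord1 coef1 /=.
  by rewrite !mul1r !mul0r subr0 addr0 scale1r.
rewrite !big_cons /= mulrBl mul1r mulrC weighted_sumB weighted_sumMXn.
have -> : x - (b + sumn l)%:R / 2 = (x - b%:R / 2) - (sumn l)%:R / 2.
  by rewrite natrD; field.
have -> : (x - b%:R / 2) - (sumn l)%:R / 2 + b%:R
    = (x + b%:R / 2) - (sumn l)%:R / 2 by field.
rewrite !IH -mulrBr -opprB (@horner_central_diff N); last first.
  by rewrite (leq_trans (size_even_diffop _ _)) // (leq_trans (size_derivn_le _ _)).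
rewrite -derivn1 -even_diffop_derivn derivn_derivn add1n even_diffop_mul natrM exprS.
ring.
Qed.

Lemma antiderivative p : exists2 g, g^`() = p & (size g <= (size p).+1)%N.
Proof.
exists (\poly_(i < (size p).+1) (p`_i.-1 / i%:R)); last exact: size_poly.
apply/polyP => i; rewrite coef_deriv coef_poly ltnS.
case: ltnP => le; last by rewrite mul0rn nth_default.
by rewrite -[LHS]mulr_natr divfK // pnatr_eq0.
Qed.

Lemma derivn_horner0 p n : p^`(n).[0] = p`_n * (n`!)%:R.
Proof. by rewrite horner_coef0 coef_derivn addn0 ffactnn mulr_natr. Qed.

(** The hook weights are those of [weighted_sum_diffs] divided by [1 - 'X]. So [f]
is first written as a central difference of step 1 of some [g], which amounts to
integrating it and applying the inverse [s] of the series [sinhc] at 1. *)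
Lemma hook_sum l f N (s : nat -> rat) : (0 < size l)%N -> (size f < N)%N ->
  s 0%N = 1 ->
  (forall k, (0 < k < N)%N -> \sum_(i < k.+1) sinhc_coef i * s (k - i)%N = 0) ->
  \sum_(a < sumn l) (hook_poly rat l)`_a * f.[a%:R + 2^-1 - (sumn l)%:R / 2]
  = (-1) ^+ (size l).-1 * (\prod_(b <- l) b)%:R
    * \sum_(i < N) \sum_(j < N) (\prod_(b <- l) sinhc id N b%:R)`_i * s j
        * f`_((size l).-1 + j.*2 + i.*2)
        * (((size l).-1 + j.*2 + i.*2)`!)%:R.
Proof.
case: N => // N l0 fN s0 srec; pose sg := \poly_(j < N.+1) s j : {poly rat}.
have [g gE gN] := antiderivative (even_diffop sg f).
have {}gN : (size g <= N.+1)%N by rewrite (leq_trans gN) // (leq_ltn_trans (size_even_diffop _ _)).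
have gD x : g.[x + 2^-1] - g.[x - 2^-1] = f.[x].
  have := horner_central_diff 1 x gN; rewrite div1r => ->.
  rewrite mul1r gE -even_diffop_mul (@even_diffop_widen _ _ _ N.+1); last by right; apply: ltnW.
  rewrite big_ord_recl big1 ?addr0 => [|i _].
    by rewrite coefM big_ord1 !coef_poly s0 sinhc_coef0 expr0 !mulr1 scale1r.
  have iN := ltn_ord (lift ord0 i).
  rewrite coefM (eq_bigr (fun k : 'I__ => sinhc_coef k * s (lift ord0 i - k)%N)).
    by rewrite srec ?iN ?andbT // scale0r.
  move=> k _; have kN : (k < N.+1)%N by apply: leq_ltn_trans iN; rewrite -ltnS.
  have k'N : (lift ord0 i - k < N.+1)%N by apply: leq_ltn_trans iN; rewrite leq_subr.
  by rewrite !coef_poly kN k'N expr1n mulr1.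
have -> : \sum_(a < sumn l) (hook_poly rat l)`_a * f.[a%:R + 2^-1 - (sumn l)%:R / 2]
   = - weighted_sum (\prod_(b <- l) (1 - 'X^b)) g (0 - (sumn l)%:R / 2).
  rewrite hook_polyE // mulrBl mul1r weighted_sumB ['X * _]mulrC weighted_sumMX opprB.
  rewrite !(weighted_sum_widen _ _ (size_hook_poly rat l)) -sumrB.
  apply: eq_bigr => a _; rewrite -mulrBr -gD; congr (_ * (_.[_] - _.[_])); by field.
rewrite (weighted_sum_diffs _ _ gN) -(prednK l0) derivSn gE -even_diffop_derivn.
rewrite exprS mulN1r !mulNr opprK; congr (_ * _).
set h := even_diffop sg _; have hN : (size h <= N.+1)%N.
  by rewrite (leq_trans (size_even_diffop _ _)) // (leq_trans (size_derivn_le _ _)) // ltnW.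
rewrite (@even_diffop_widen _ _ _ N.+1); last by right.
rewrite horner_sum; apply: eq_bigr => i _; rewrite hornerZ /h -even_diffop_derivn.
rewrite derivn_derivn (@even_diffop_widen _ _ _ N.+1); last by left; apply: size_poly.
rewrite horner_sum mulr_sumr; apply: eq_bigr => j _.
rewrite coef_poly ltn_ord hornerZ derivn_derivn derivn_horner0 -!mulrA.
by have -> : (j.*2 + (i.*2 + (size l).-1) = (size l).-1 + j.*2 + i.*2)%N by lia.
Qed.

End HookSum.

(** * Shifted power sums of hooks *)

Section PowerSums.

(** The terms of the rows of length 1 telescope. *)
Lemma p_shift_hook k d a : (a < d)%N ->
  p_shift k (hook d a)
  = (d%:R - a%:R - 2^-1) ^+ k - (- a%:R - 2^-1) ^+ k.
Proof.
move=> ad; rewrite /p_shift /hook [size _]/= size_nseq big_ord_recl [nth _ _ _]/=.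
pose h i : rat := (- i.+1%:R + 2^-1) ^+ k.
rewrite (eq_bigr (fun i : 'I_a => h i - h i.+1)) => [|i _]; last first.
  rewrite lift0 /= nth_nseq ltn_ord /h; congr (_ ^+ _ - _).
  by rewrite -[i.+2%:R]nat1r; ring.
have -> : \sum_(i < a) (h i - h i.+1) = h 0%N - h a.
  elim: (a) => [|b IH]; first by rewrite big_ord0 subrr.
  by rewrite big_ord_recr /= IH addrA subrK.
rewrite addrA subrK /h natrB 1?ltnW //; congr (_ ^+ _ - _ ^+ _); first by rewrite /=; field.
by rewrite -natr1; field.
Qed.

(** Up to sign and after rescaling to size one, the shifted power sum of a hook,
divided by [k`!], as a polynomial in the position of the hook measured from the
middle one. This origin makes all the coefficients nonnegative. *)
Definition hook_power_sum (k : nat) : {poly rat} :=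
  (k`!)%:R^-1 *: (('X + (2^-1)%:P) ^+ k - ('X - (2^-1)%:P) ^+ k).

Lemma hook_power_sumE k (d u : rat) : d != 0 ->
  d ^+ k * (hook_power_sum k).[u / d]
  = ((u + d / 2) ^+ k - (u - d / 2) ^+ k) / (k`!)%:R.
Proof.
move=> d0; rewrite /hook_power_sum hornerZ hornerD hornerN !horner_exp.
rewrite !hornerD !hornerN hornerX !hornerC.
rewrite mulrCA mulrC mulrBr -!exprMn; congr ((_ ^+ _ - _ ^+ _) / _); field => //.
Qed.

Definition nneg_coefs (p : {poly rat}) : Prop := forall i, 0 <= p`_i.

Lemma nneg_coefsD p q : nneg_coefs p -> nneg_coefs q -> nneg_coefs (p + q).
Proof. by move=> P Q i; rewrite coefD addr_ge0. Qed.

Lemma nneg_coefsM p q : nneg_coefs p -> nneg_coefs q -> nneg_coefs (p * q).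
Proof. by move=> P Q i; rewrite coefM sumr_ge0 // => j _; rewrite mulr_ge0. Qed.

Lemma nneg_coefsC c : 0 <= c -> nneg_coefs c%:P.
Proof. by move=> c0 i; rewrite coefC; case: eqP. Qed.

Lemma nneg_coefs_prod I r (F : I -> {poly rat}) :
  (forall i, nneg_coefs (F i)) -> nneg_coefs (\prod_(i <- r) F i).
Proof.
move=> H; elim/big_rec: _ => [|i p _ IH]; first exact: nneg_coefsC.
exact: nneg_coefsM.
Qed.

Lemma hook_power_sum_nneg k : nneg_coefs (hook_power_sum k).
Proof.
rewrite /hook_power_sum -mul_polyC; apply: nneg_coefsM.
  by apply: nneg_coefsC; rewrite invr_ge0 ler0n.
rewrite exprDn exprBn -sumrB.
elim/big_rec: _ => [|i p _ IH]; first by move=> r; rewrite coef0.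
apply: nneg_coefsD IH.
have M : nneg_coefs ('X^(k - i) * (2^-1)%:P ^+ i *+ 'C(k, i)).
  move=> r; rewrite coefMn mulrn_wge0 // -polyC_exp mulrC coefCM coefXn.
  by rewrite mulr_ge0 ?exprn_ge0 // ler0n.
rewrite -signr_odd; case: odd; rewrite ?expr1 ?expr0 ?mul1r ?subrr.
  by rewrite mulN1r mulNr mulNrn opprK; apply: nneg_coefsD.
by move=> r; rewrite coef0.
Qed.

(** The difference of the two [k]-th powers is [1] times a sum of [k] monic
polynomials of degree [k.-1]. *)
Lemma coef_hook_power_sum_pred k : (0 < k)%N ->
  (hook_power_sum k)`_k.-1 != 0 /\ size (hook_power_sum k) = k.
Proof.
move=> k0; pose c : rat := 2^-1.
pose t i : {poly rat} := ('X + c%:P) ^+ (k.-1 - i) * ('X - c%:P) ^+ i.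
have E : hook_power_sum k = (k`!)%:R^-1 *: \sum_(i < k) t i.
  rewrite /hook_power_sum subrXX (_ : _ - _ = 1) ?mul1r; last first.
    rewrite opprB addrC addrA subrK -polyCD; congr _%:P; rewrite /c; field.
  by congr (_ *: _); apply: eq_bigr => i _; rewrite /t subnS -subn1 subnAC subn1.
have tm (i : 'I_k) : size (t i) = k /\ (t i)`_k.-1 = 1.
  have plus : 'X + c%:P = 'X - (- c)%:P by rewrite polyCN opprK.
  have mon : t i \is monic.
    by rewrite /t plus rpredM ?rpredX ?monicXsubC.
  have sz : size (t i) = k.
    rewrite /t plus size_Mmonic ?rpredX ?monicXsubC //; last first.
      by rewrite expf_neq0 // polyXsubC_eq0.
    by rewrite !size_exp_XsubC; have := ltn_ord i; lia.
  by split=> //; rewrite -[RHS](monicP mon) lead_coefE sz.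
have c0 : (hook_power_sum k)`_k.-1 = k%:R / (k`!)%:R.
  rewrite E coefZ coef_sum (eq_bigr (fun=> 1)); last by move=> i _; case: (tm i).
  by rewrite sumr_const card_ord mulrC.
have nz : (hook_power_sum k)`_k.-1 != 0.
  by rewrite c0 mulf_neq0 ?invr_neq0 // pnatr_eq0 -lt0n ?fact_gt0.
split=> //; apply/eqP; rewrite eqn_leq; apply/andP; split.
  rewrite E (leq_trans (size_scale_leq _ _)) //.
  apply: leq_trans (size_sum _ _ _) _; apply/bigmax_leqP => i _.
  by case: (tm i) => ->.
rewrite -[k in X in (X <= _)%N](prednK k0); case: ltnP => // le.
by rewrite nth_default // eqxx in nz.
Qed.

End PowerSums.

Section ProductOfPowerSums.

Variables (s : nat) (k : 'I_s -> nat).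
Hypothesis k_gt0 : forall i, (0 < k i)%N.
Let K := (\sum_i k i)%N.

Definition hook_power_prod : {poly rat} := \prod_i hook_power_sum (k i).

Lemma size_hook_power_prod : size hook_power_prod = (K - s).+1.
Proof.
have nz i : hook_power_sum (k i) != 0.
  by have [+ _] := coef_hook_power_sum_pred (k_gt0 i); apply: contraNneq => ->; rewrite coef0.
rewrite /hook_power_prod size_prod; last by move=> i _; apply: nz.
rewrite (eq_bigr k) => [|i _]; last by case: (coef_hook_power_sum_pred (k_gt0 i)).
rewrite -/K cardT size_enum_ord subSn //.
rewrite -[s in (s <= _)%N]card_ord -sum1_card; exact: leq_sum.
Qed.

Lemma hook_power_prod_lead : hook_power_prod`_(K - s) != 0.
Proof.
have := lead_coef_eq0 hook_power_prod; rewrite lead_coefE size_hook_power_prod /=.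
by move=> ->; rewrite -size_poly_eq0 size_hook_power_prod.
Qed.

Lemma hook_power_prod_nneg : nneg_coefs hook_power_prod.
Proof. by apply: nneg_coefs_prod => i; apply: hook_power_sum_nneg. Qed.

(** The homogeneous form of [hook_power_prod], of total degree [K]. *)
Definition hook_power_hom (d : rat) : {poly rat} :=
  \poly_(r < K.+1) (hook_power_prod`_r * d ^+ (K - r)).

Lemma hook_power_homE d u : d != 0 ->
  (hook_power_hom d).[u] =
  \prod_i (((u + d / 2) ^+ k i - (u - d / 2) ^+ k i) / ((k i)`!)%:R).
Proof.
move=> d0; under [RHS]eq_bigr => i _ do rewrite -hook_power_sumE //.
rewrite big_split /= -horner_prod -expr_sum -/K -/hook_power_prod.
rewrite horner_poly (horner_coef_wide (n := K.+1)); last first.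
  by rewrite size_hook_power_prod ltnS leq_subr.
rewrite mulr_sumr; apply: eq_bigr => -[r /=]; rewrite ltnS => rK _.
have -> : d ^+ K = d ^+ (K - r) * d ^+ r by rewrite -exprD subnK.
have dr : d ^+ r != 0 by rewrite expf_neq0.
by rewrite expr_div_n; field.
Qed.

Lemma prod_p_shift_hook d a : (a < d)%N ->
  \prod_i (p_shift (k i) (hook d a) / ((k i)`!)%:R)
  = (-1) ^+ (K + s) * (hook_power_hom d%:R).[a%:R + 2^-1 - d%:R / 2].
Proof.
move=> ad; have d0 : d%:R != 0 :> rat by rewrite pnatr_eq0 -lt0n (leq_ltn_trans _ ad).
rewrite hook_power_homE //.
have -> : (-1) ^+ (K + s) = \prod_i ((-1) ^+ (k i).+1) :> rat.
  rewrite -expr_sum; congr (_ ^+ _).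
  transitivity (K + \sum_(i < s) 1)%N; first by rewrite sum1_card card_ord.
  by rewrite -big_split; apply: eq_bigr => i _; rewrite /= addn1.
rewrite -big_split /=; apply: eq_bigr => i _; rewrite mulrA p_shift_hook //.
congr (_ / _); rewrite exprS mulN1r mulNr mulrBr opprB -!exprMn.
by congr (_ ^+ _ - _ ^+ _); field.
Qed.

End ProductOfPowerSums.

Section Polynomial.

Variable n : nat.
Local Notation MP := {mpoly rat[n]}.

Definition sinhc_prod N (l : seq MP) : {poly MP} :=
  \prod_(x <- l) sinhc (@mpolyC n rat) N x.

(** The coefficient [i] collects the monomials with even exponents adding up to
[i.*2]. *)
Lemma sinhc_prod_homog N (l : seq MP) i :
  {in l, forall x, x \is 1.-homog} -> (sinhc_prod N l)`_i \is i.*2.-homog.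
Proof.
elim: l i => [|x l IH] i hl.
  rewrite /sinhc_prod big_nil coef1; by case: i => [|i] /=; [apply: dhomog1|apply: dhomog0].
rewrite /sinhc_prod big_cons coefM; apply: rpred_sum => -[j /=]; rewrite ltnS => ji _.
have -> : i.*2 = (j.*2 + (i - j).*2)%N by rewrite -doubleD subnKC.
apply: dhomogM; last by apply: IH => y yl; apply: hl; rewrite inE yl orbT.
rewrite coef_poly; case: ifP => _; last exact: dhomog0.
rewrite mul_mpolyC; apply: dhomogZ.
have := dhomogMn j.*2 (hl x (mem_head _ _)); by rewrite mul1n.
Qed.


Lemma meval_sinhc_prod N (l : seq MP) v i :
  ((sinhc_prod N l)`_i).@[v]
  = (\prod_(x <- l) sinhc id N (x.@[v]))`_i.
Proof.
rewrite -(coef_map (meval v)) /sinhc_prod rmorph_prod.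
suff -> : \prod_(x <- l) map_poly (meval v) (sinhc (@mpolyC n rat) N x)
  = \prod_(x <- l) sinhc id N (x.@[v]) by [].
apply: eq_bigr => x _; rewrite map_sinhc.
apply/polyP => j; rewrite !coef_poly /=; case: ifP => // _.
by rewrite mevalC.
Qed.

(** Substituting one indeterminate for all the variables keeps track of the total
degree, and keeps the terms with positive coefficients from cancelling. *)
Definition diag_subst (p : MP) : {poly rat} := mmap (@polyC rat) (fun=> 'X) p.

Lemma coef_diag_subst p e : (diag_subst p)`_e = \sum_(m <- msupp p | mdeg m == e) p@_m.
Proof.
rewrite /diag_subst /mmap coef_sum [RHS]big_mkcond; apply: eq_bigr => m _ /=.
rewrite coefCM /mmap1 -expr_sum -mdegE coefXn eq_sym.
by case: eqP; rewrite ?mulr1 ?mulr0.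
Qed.

Lemma diag_subst_msupp p e : (diag_subst p)`_e != 0 -> exists2 m, m \in msupp p & mdeg m = e.
Proof.
rewrite coef_diag_subst => nz.
have : has (fun m => mdeg m == e) (msupp p).
  apply: contraNT nz => /hasPn h; rewrite big1_seq // => m /andP[me mp].
  by have := h m mp; rewrite me.
by case/hasP => m mp /eqP me; exists m.
Qed.

End Polynomial.

(** * The polynomial and its degrees *)

Section SinhPowers.

Lemma coef_sinhc_diag N m i :
  (\prod_(j < m) sinhc (@polyC rat) N 'X)`_i
  = (\prod_(j < m) sinhc id N 1)`_i *: 'X^(i.*2).
Proof.
elim: m i => [|m IH] i.
  by rewrite !big_ord0 !coef1; case: i => [|i]; rewrite ?scale1r ?expr0 //= scale0r.
rewrite !big_ord_recl !coefM scaler_suml; apply: eq_bigr => -[j /=]; rewrite ltnS => ji _.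
rewrite IH !coef_poly; case: ifP => _; last by rewrite !mul0r scale0r.
rewrite expr1n mulr1 mul_polyC -scalerAl -scalerAr scalerA -exprD.
by rewrite -doubleD subnKC.
Qed.

Lemma sinhc_pow_ge0 N m i : 0 <= (\prod_(j < m) sinhc id N (1 : rat))`_i.
Proof.
apply: nneg_coefs_prod => _ j; rewrite coef_poly; case: ifP => // _.
by rewrite expr1n mulr1 ltW // sinhc_coef_gt0.
Qed.

Lemma sinhc_pow0 N m : (0 < N)%N -> (\prod_(j < m) sinhc id N (1 : rat))`_0 = 1.
Proof.
move=> N0; elim: m => [|m IH]; first by rewrite big_ord0 coef1.
by rewrite big_ord_recl coefM big_ord1 IH coef_poly N0 sinhc_coef0 !mulr1.
Qed.

(** The constant terms being 1, the coefficient of index [i] of a single factor is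
one of the nonnegative terms of the sum. *)
Lemma sinhc_pow_gt0 N m i : (0 < m)%N -> (i < N)%N ->
  0 < (\prod_(j < m) sinhc id N (1 : rat))`_i.
Proof.
case: m => // m _ iN; rewrite big_ord_recl coefM big_ord_recr /=.
rewrite subnn sinhc_pow0 ?(leq_ltn_trans _ iN) // mulr1 addrC.
apply: ltr_pwDl; first by rewrite coef_poly iN expr1n mulr1 sinhc_coef_gt0.
apply: sumr_ge0 => j _; rewrite mulr_ge0 ?sinhc_pow_ge0 //.
by rewrite coef_poly; case: ifP => // _; rewrite expr1n mulr1 ltW // sinhc_coef_gt0.
Qed.

End SinhPowers.

(** [sg] stands for the inverse of the series [sinhc] at 1, and [g] for the genus.
The polynomial is the value of [hook_sum] at formal parts. *)
Section HurwitzPolynomial.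

Variables (n s g K : nat) (k : 'I_s -> nat) (sg : nat -> rat).
Hypotheses (n_gt0 : (0 < n)%N) (k_gt0 : forall i, (0 < k i)%N).
Hypothesis K_sum : K = (\sum_i k i)%N.
Hypothesis K_genus : K = (s + n.-1 + g.*2)%N.
Local Notation N := K.+2.
Hypothesis sg0 : sg 0%N = 1.
Hypothesis sg_neq0 : forall j, (j < N)%N -> sg j != 0.

Local Notation MP := {mpoly rat[n]}.

Definition mpoly_vars : seq MP := [seq 'X_j | j <- enum 'I_n].
Definition size_var : MP := \sum_j 'X_j.

Definition term_deg (i j : nat) : nat := (n.-1 + j.*2 + i.*2)%N.

Definition term_coef (i j : nat) : rat :=
  sg j * (hook_power_prod k)`_(term_deg i j) * ((term_deg i j)`!)%:R.

Definition hurwitz_term (i j : nat) : MP :=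
  (term_coef i j)%:MP * ((sinhc_prod N mpoly_vars)`_i * size_var ^+ (K - term_deg i j)).

Definition hurwitz_poly : MP :=
  ((-1) ^+ (K + s + n.-1))%:MP * \sum_(i < N) \sum_(j < N) hurwitz_term i j.

Lemma term_coef_neq0 i j : term_coef i j != 0 -> (term_deg i j <= K - s)%N.
Proof.
rewrite /term_coef K_sum -ltnS -(size_hook_power_prod k_gt0); case: ltnP => // le.
by rewrite nth_default // mulr0 mul0r eqxx.
Qed.

Lemma size_var_homog : size_var \is 1.-homog.
Proof. by apply: rpred_sum => j _; rewrite dhomogX; apply/eqP/mdeg1. Qed.

Lemma term_homog i j : hurwitz_term i j \is (i.*2 + (K - term_deg i j)).-homog.
Proof.
rewrite /hurwitz_term mul_mpolyC; apply/dhomogZ/dhomogM.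
  apply: sinhc_prod_homog => x /mapP[v _ ->]; by rewrite dhomogX; apply/eqP/mdeg1.
by have := dhomogMn (K - term_deg i j) size_var_homog; rewrite mul1n.
Qed.

(** The term of indices [i] and [j] has degree [K - term_deg i j + i.*2]. This is
at least [s] since [term_deg i j <= K - s], and it is [s + (g - j).*2] whenever
[j] is at most [g]. *)
Lemma mdeg_hurwitz_poly m : m \in msupp hurwitz_poly ->
  (s <= mdeg m <= s + g.*2)%N.
Proof.
move=> mP; apply: contraTT mP => deg; rewrite mcoeff_msupp negbK.
rewrite /hurwitz_poly mcoeffCM !raddf_sum big1 ?mulr0 //= => i _.
rewrite raddf_sum big1 //= => j _.
have [c0|c0] := eqVneq (term_coef i j) 0; first by rewrite /hurwitz_term c0 mul0r mcoeff0.
apply: (dhomog_nemf_coeff (term_homog i j)); apply: contraNneq deg => ->.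
have := term_coef_neq0 c0; move: K_genus; rewrite /term_deg; lia.
Qed.

Definition sinhc_pow_coef i : rat := (\prod_(j < n) sinhc id N (1 : rat))`_i.

Lemma diag_subst_term i j :
  diag_subst (hurwitz_term i j)
  = (term_coef i j * sinhc_pow_coef i * n%:R ^+ (K - term_deg i j))
    *: 'X^(i.*2 + (K - term_deg i j)).
Proof.
rewrite /diag_subst /hurwitz_term rmorphM /= mmapC rmorphM rmorphXn /=.
have -> : mmap (@polyC rat) (fun=> 'X) size_var = n%:R *: 'X.
  rewrite /size_var rmorph_sum /=.
  rewrite (eq_bigr (fun=> 'X)) => [|v _]; last by rewrite mmapX mmap1U.
  by rewrite sumr_const card_ord scaler_nat.
have -> : mmap (@polyC rat) (fun=> 'X) (sinhc_prod N mpoly_vars)`_i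
    = sinhc_pow_coef i *: 'X^(i.*2).
  rewrite -coef_sinhc_diag -(coef_map (mmap (@polyC rat) (fun=> 'X))).
  rewrite /sinhc_prod rmorph_prod.
  suff -> : \prod_(x <- mpoly_vars)
      map_poly (mmap (@polyC rat) (fun=> 'X)) (sinhc (@mpolyC n rat) N x)
    = \prod_(j < n) sinhc (@polyC rat) N 'X by [].
  rewrite /mpoly_vars big_map big_enum; apply: eq_bigr => v _; rewrite map_sinhc /=.
  rewrite mmapX mmap1U; apply/polyP => r; rewrite !coef_poly /=.
  by case: ifP => // _; rewrite mmapC.
by rewrite exprZn mul_polyC -scalerAl -scalerAr !scalerA -exprD ?mulrA.
Qed.

Lemma coef_diag_subst_hurwitz e :
  (diag_subst hurwitz_poly)`_e
  = (-1) ^+ (K + s + n.-1) * \sum_(i < N) \sum_(j < N)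
     (term_coef i j * sinhc_pow_coef i * n%:R ^+ (K - term_deg i j))
      *+ ((i.*2 + (K - term_deg i j))%N == e).
Proof.
rewrite /hurwitz_poly /diag_subst rmorphM rmorph_sum /= mmapC coefCM.
rewrite coef_sum; congr (_ * _); apply: eq_bigr => i _.
rewrite rmorph_sum coef_sum; apply: eq_bigr => j _ /=.
by rewrite -/(diag_subst _) diag_subst_term coefZ coefXn eq_sym mulr_natr.
Qed.

(** In degree [s] only the indices [0] and [g] remain; the coefficient is a nonzero
multiple of [sg g]. *)
Lemma lowest_degree_hurwitz : lowest_degree hurwitz_poly s.
Proof.
split; last by move=> m /mdeg_hurwitz_poly/andP[].
apply: diag_subst_msupp; rewrite coef_diag_subst_hurwitz mulf_neq0 ?signr_eq0 //.
have gN : (g < N)%N by rewrite K_genus; lia.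
rewrite (bigD1 ord0) //= [X in _ + X]big1 ?addr0; last first.
  move=> i i0; rewrite big1 // => j _; case: eqP => // E.
  have [->|/term_coef_neq0] := eqVneq (term_coef i j) 0; first by rewrite !mul0r.
  have i1 : (0 < i)%N by rewrite lt0n; apply: contraNneq i0 => i0; apply/eqP/val_inj.
  move=> le; exfalso; move: K_genus le E; lia.
rewrite (bigD1 (Ordinal gN)) //= [X in _ + X]big1 ?addr0; last first.
  move=> j jg; case: eqP => // E.
  have [->|/term_coef_neq0] := eqVneq (term_coef 0 j) 0; first by rewrite !mul0r.
  move=> le; exfalso; move: jg K_genus le E; rewrite /term_deg -val_eqE /= => /eqP; lia.
have -> : ((0 + (K - term_deg 0 g))%N == s) by rewrite /term_deg; apply/eqP; lia.
rewrite mulr1n !mulf_neq0 ?expf_neq0 ?pnatr_eq0 -?lt0n ?fact_gt0 ?sg_neq0 //.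
  rewrite (_ : term_deg 0 g = K - s)%N; last by rewrite /term_deg; lia.
  by rewrite K_sum hook_power_prod_lead.
by rewrite gt_eqF // sinhc_pow_gt0.
Qed.

(** In degree [s + g.*2] only the terms with [j = 0] remain, whose coefficients
all have the same sign; the one with [i = g] does not vanish. *)
Lemma highest_degree_hurwitz : highest_degree hurwitz_poly (s + g.*2).
Proof.
split; last by move=> m /mdeg_hurwitz_poly/andP[].
apply: diag_subst_msupp; rewrite coef_diag_subst_hurwitz mulf_neq0 ?signr_eq0 //.
have gN : (g < N)%N by rewrite K_genus; lia.
have zero (i j : nat) : (0 < j)%N ->
  (term_coef i j * sinhc_pow_coef i * n%:R ^+ (K - term_deg i j))
      *+ ((i.*2 + (K - term_deg i j))%N == (s + g.*2)%N) = 0.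
  move=> j0; case: eqP => // E.
  have [->|/term_coef_neq0] := eqVneq (term_coef i j) 0; first by rewrite !mul0r.
  by move=> le; exfalso; move: K_genus le E; rewrite /term_deg; lia.
have nneg (i : nat) : 0 <= (term_coef i 0 * sinhc_pow_coef i * n%:R ^+ (K - term_deg i 0))
      *+ ((i.*2 + (K - term_deg i 0))%N == (s + g.*2)%N).
  apply: mulrn_wge0; rewrite /term_coef sg0 mul1r.
  by rewrite !mulr_ge0 ?exprn_ge0 ?sinhc_pow_ge0 // hook_power_prod_nneg.
under eq_bigr => i _.
  rewrite (bigD1 ord0) //= [X in _ + X]big1 ?addr0; last first.
    move=> j j0; apply: zero; rewrite lt0n; apply: contraNneq j0 => j0.
    exact/eqP/val_inj.
  over.
rewrite (bigD1 (Ordinal gN)) //= gt_eqF //; apply: ltr_pwDl;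
  last by apply: sumr_ge0 => i _; apply: nneg.
have degE : term_deg g 0 = (K - s)%N by rewrite /term_deg; lia.
rewrite degE (_ : _ == _) ?mulr1n; last by apply/eqP; lia.
rewrite /term_coef sg0 mul1r degE !mulr_gt0 ?exprn_gt0 ?ltr0n ?fact_gt0 ?sinhc_pow_gt0 //.
by rewrite lt0r hook_power_prod_nneg K_sum hook_power_prod_lead.
Qed.

Lemma meval_hurwitz_poly (beta : n.-tuple nat) :
  hurwitz_poly.@[fun j => (tnth beta j)%:R]
  = (-1) ^+ (K + s + n.-1) * \sum_(i < N) \sum_(j < N)
      (\prod_(b <- beta) sinhc id N b%:R)`_i * sg j
        * (hook_power_hom k (sumn beta)%:R)`_(term_deg i j) * ((term_deg i j)`!)%:R.
Proof.
rewrite /hurwitz_poly mevalM mevalC rmorph_sum /=; congr (_ * _).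
apply: eq_bigr => i _; rewrite rmorph_sum /=; apply: eq_bigr => j _.
rewrite /hurwitz_term !mevalM mevalC meval_sinhc_prod rmorphXn /=.
have -> : size_var.@[fun j => (tnth beta j)%:R] = (sumn beta)%:R :> rat.
  rewrite /size_var rmorph_sum /= sumnE natr_sum big_tuple.
  by apply: eq_bigr => v _; rewrite mevalXU.
have -> : \prod_(x <- mpoly_vars) sinhc id N (x.@[fun j => (tnth beta j)%:R])
   = \prod_(b <- beta) sinhc id N (b%:R : rat).
  rewrite /mpoly_vars big_map big_enum big_tuple; apply: eq_bigr => v _.
  by rewrite mevalXU.
rewrite /hook_power_hom coef_poly /term_coef -K_sum; case: ltnP => le; first by ring.
rewrite nth_default ?(size_hook_power_prod k_gt0) -?K_sum; last first.
  by rewrite (leq_trans _ le) // ltnS leq_subr.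
by rewrite !(mulr0, mul0r).
Qed.

End HurwitzPolynomial.

(** * The theorem *)

(* beta is the sequence of parts in arbitrary order; [sort geq beta] is the
   partition it represents. *)
Theorem theorem6p3 (kappa : nat -> seq nat -> rat)
    (hkappa : shifted_coefs kappa)
    (n s : nat) (k : s.-tuple nat) (g : nat)
    (n_gt0 : (0 < n)%N) (s_gt0 : (0 < s)%N)
    (k_gt0 : forall i : 'I_s, (0 < tnth k i)%N)
    (hg : (\sum_(i < s) tnth k i)%N%:Z - s%:Z - n%:Z + 1 = (2 * g)%N%:Z) :
  exists P : {mpoly rat[n]},
    (forall beta : n.-tuple nat, (forall j : 'I_n, (0 < tnth beta j)%N) ->
       let b := sumn beta in
       P.@[fun j => (tnth beta j)%:R] =
         hurwitz_m kappa b b k [tuple [:: b]; sort geq beta]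
         * (Aut_part beta)%:R * b%:R) /\
    lowest_degree P s /\
    highest_degree P (\sum_(i < s) tnth k i - n + 1)%N.
Proof.
set K := (\sum_(i < s) tnth k i)%N in hg *.
have KE : K = (s + n.-1 + g.*2)%N by move: K hg => K hg; lia.
have [sg [sg0 sgN srec]] := inv_sinhc K.+2.
exists (hurwitz_poly n K (tnth k) sg); split; last first.
  split; first exact: (@lowest_degree_hurwitz _ _ g).
  rewrite (_ : (K - n + 1)%N = (s + g.*2)%N); last by move: K KE {hg srec sgN}; lia.
  exact: (@highest_degree_hurwitz _ _ g).
move=> beta b_gt0 b.
rewrite meval_hurwitz_poly //.
pose l := sort geq beta.
have lb : perm_eq l beta by rewrite perm_sort.
have b0 : (0 < b)%N.
  rewrite /b sumnE big_tuple (bigD1 (Ordinal n_gt0)) //= ltn_addr //.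
have lp : is_part l.
  rewrite /is_part sort_sorted /=; last by move=> x y; rewrite /geq /= leq_total.
  rewrite mem_sort; apply/negP => /tnthP[j bj].
  by have := b_gt0 j; rewrite -bj.
have ls : sumn l = b by apply: perm_sumn.
have lsize : size l = n by rewrite size_sort size_tuple.
have prod0 : (\prod_(c <- l) c)%:R != 0 :> rat.
  rewrite pnatr_eq0 -lt0n (perm_big _ lb) big_tuple prodn_gt0 //.
have := hurwitz_hook hkappa b0 k_gt0 lp ls.
move/(fmorph_inj (ratr : {rmorphism rat -> algC})) => H.
apply: (mulfI prod0).
transitivity ((centraliser_order l)%:R * (hurwitz_m kappa b b k [tuple [:: b]; l] * b%:R)); last first.
  rewrite /centraliser_order natrM (Aut_part_perm lb) /l; ring.
rewrite H.
under [RHS]eq_bigr => a _ do rewrite (@prod_p_shift_hook s (tnth k)) // mulrCA.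
rewrite -mulr_sumr -ls (@hook_sum l _ K.+2 sg) ?lsize //; last first.
  by rewrite ltnS size_poly.
rewrite ls (perm_big _ lb (F := fun c => sinhc id K.+2 c%:R)) /= !mulrA.
rewrite -exprD [(\prod_(c <- l) c)%:R * _]mulrC.
congr (_ * _ * _).
Qed.
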